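(* Let $k$ be an algebraically closed field and $G$ a finite group such that the characteristic $p>0$ of $k$ divides $|G|$; write $|G|=p^aq$ with $q$ prime to $p$. Suppose $G$ has exactly one Sylow $p$-subgroup and it is cyclic. The following are equivalent: (i) the Lie algebra $\operatorname{H}^1(kG,kG)$ is semisimple; (ii) $G$ is the direct product of a group $K$ of order $q$ and a cyclic group of order $p$, and $p\neq2$; (iii) $\operatorname{H}^1(kG,kG)$ is a product of Witt algebras $W(1,1):=\operatorname{Der}(k[X]/(X^p))$, and $p\neq2$.
   Context: $\operatorname{H}^1(kG,kG)$ is the first Hochschild cohomology of the group algebra $kG$, i.e. the Lie algebra of $k$-linear derivations of $kG$ modulo inner derivations, with the commutator bracket. A Lie algebra is semisimple if its solvable radical is zero. *)

(* Defs.v *)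
From HB Require Import structures.
From mathcomp Require Import all_boot all_order all_algebra all_fingroup all_solvable all_field.
Set Implicit Arguments. Unset Strict Implicit. Unset Printing Implicit Defensive.
Import Order.TTheory GRing.Theory.
Local Open Scope ring_scope.

Section Derivations.
Variables (k : fieldType) (V : lmodType k) (mul : V -> V -> V).

Definition is_der (D : V -> V) : Prop :=
  [/\ forall a b, D (a + b) = D a + D b,
      forall (c : k) a, D (c *: a) = c *: D a
    & forall a b, D (mul a b) = mul (D a) b + mul a (D b)].

Definition is_inner (D : V -> V) : Prop :=
  exists x : V, forall a, D a = mul x a - mul a x.

Definition Inn (D : V -> V) : Prop := is_der D /\ is_inner D.

Definition lbr (D E : V -> V) : V -> V := fun a => D (E a) - E (D a).

Definition is_subspace (S : (V -> V) -> Prop) : Prop :=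
  [/\ S (fun _ => 0),
      forall D E, S D -> S E -> S (fun a => D a + E a)
    & forall (c : k) D, S D -> S (fun a => c *: D a)].

Definition brspan (S T : (V -> V) -> Prop) (F : V -> V) : Prop :=
  exists (n : nat) (c : 'I_n -> k) (Ds Es : 'I_n -> V -> V),
    (forall i, S (Ds i)) /\ (forall i, T (Es i)) /\
    F = (fun a => \sum_(i < n) c i *: lbr (Ds i) (Es i) a).

Definition der_ideal (J : (V -> V) -> Prop) : Prop :=
  [/\ is_subspace J, (forall D, J D -> is_der D)
    & forall D E, is_der D -> J E -> J (lbr D E)].

Fixpoint dser_mod (J I : (V -> V) -> Prop) (n : nat) : (V -> V) -> Prop :=
  match n with
  | 0 => J
  | n'.+1 => fun F => exists D1 D2, brspan (dser_mod J I n') (dser_mod J I n') D1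
               /\ I D2 /\ F = (fun a => D1 a + D2 a)
  end.

(* The Lie algebra H^1 = Der(V)/Inn(V) is semisimple: its solvable radical is
   zero, i.e. every solvable ideal of Der/Inn is zero.  Ideals of Der/Inn
   correspond to ideals J of Der containing Inn, and J/Inn is solvable iff
   some term of the derived series of J lies in Inn modulo Inn. *)
Definition H1_semisimple : Prop :=
  forall J : (V -> V) -> Prop, der_ideal J -> (forall D, Inn D -> J D) ->
    (exists n, forall D, dser_mod J Inn n D -> Inn D) ->
    forall D, J D -> Inn D.

End Derivations.

Definition grpalg (k : fieldType) (gT : finGroupType) := {ffun gT -> k^o}.
Definition galg_mul (k : fieldType) (gT : finGroupType)
  (a b : {ffun gT -> k^o}) : {ffun gT -> k^o} :=
  [ffun g => \sum_(h : gT) a h * b (h^-1 * g)%g].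

(* The truncated polynomial algebra k[X]/(X^p), in the basis 1, X, ..., X^(p-1):
   coefficient vectors indexed by 'I_p, with truncated multiplication. *)
Definition trunc_mul (k : fieldType) (p : nat) (a b : {ffun 'I_p -> k^o})
  : {ffun 'I_p -> k^o} :=
  [ffun n : 'I_p => \sum_(i < p) \sum_(j < p | (i + j == n)%N) a i * b j].

(* H^1(A,A) = Der(A)/Inn(A) is isomorphic, as a Lie algebra, to the product of
   m copies of the Witt algebra W(1,1) = Der(k[X]/(X^p)).  Stated through the
   first isomorphism theorem: a Lie algebra homomorphism phi from Der(A) onto
   W(1,1)^m (componentwise bracket) whose kernel is exactly Inn(A). *)
Definition H1_iso_Witt_power (k : fieldType) (V : lmodType k)
  (mul : V -> V -> V) (p m : nat) : Prop :=
  exists phi : (V -> V) -> 'I_m -> {ffun 'I_p -> k^o} -> {ffun 'I_p -> k^o},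
  (forall D, is_der mul D -> forall i, is_der (@trunc_mul k p) (phi D i)) /\
  [/\ forall D E, is_der mul D -> is_der mul E ->
        forall i x, phi (fun a => D a + E a) i x = phi D i x + phi E i x,
      forall (c : k) D, is_der mul D ->
        forall i x, phi (fun a => c *: D a) i x = c *: phi D i x,
      forall D E, is_der mul D -> is_der mul E ->
        forall i x, phi (lbr D E) i x = lbr (phi D i) (phi E i) x,
      forall F : 'I_m -> {ffun 'I_p -> k^o} -> {ffun 'I_p -> k^o},
        (forall i, is_der (@trunc_mul k p) (F i)) ->
        exists D, is_der mul D /\ forall i x, phi D i x = F i x
    & forall D, is_der mul D ->
        ((forall i x, phi D i x = 0) <-> is_inner mul D)].

(* Main.v *)
Require Import Defs.
From HB Require Import structures.
From mathcomp Require Import all_boot all_order all_algebra all_fingroup all_solvable all_field.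
From mathcomp Require Import mxrepresentation ring.
From Stdlib Require Import FunctionalExtensionality ClassicalEpsilon.

(** The class of a derivation D of kG modulo inner derivations is detected by the
coefficients of D(g) at xg, for x commuting with a p-element g.

Write G = P E with P = <u> normal and E a p'-complement.  Conjugation on P gives
a character chi of G with values in the prime field, and the discrete logarithm
on P extends to a chi-crossed homomorphism ell.  Let e0 be the averaging
idempotent of C_E(P).  Then f := F(u) e0, for F a chi-equivariant polynomial,
gives the derivation g |-> ell(g) f g, these represent all classes in the block
e0 kG, and the bracket becomes the Wronskian X (F G' - G F').  If chi is
nontrivial, every such F is divisible by X - 1, and the powers of X - 1 show that
this ideal is solvable.  If P is central of order N <> p, the multiples of
(X - 1)^(N - p), a polynomial of zero derivative, form an abelian ideal, and if
p = 2 so do the F with X F' = F.  So semisimplicity forces G = E x P with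
|P| = p odd.

If G = K x C with |C| = p, the central idempotents of kK identify the centre of
kG with a product of copies of k[X]/(X^p), and D |-> D restricted to the centre
identifies H^1 with the product of the derivation algebras.  Finally, a nonzero
ideal of a power of W(1,1), with p odd, contains the perfect subalgebra spanned by
d/dX, X d/dX and X^2 d/dX in some component, hence is not solvable. *)

Set Implicit Arguments.
Unset Strict Implicit.
Unset Printing Implicit Defensive.
Import GRing.Theory.
Local Open Scope ring_scope.

(** * The group algebra and its derivations *)

Section GroupAlgebra.
Variables (k : fieldType) (gT : finGroupType).
Implicit Types (a b c : {ffun gT -> k^o}) (g h x : gT).

Definition gbase g : {ffun gT -> k^o} := [ffun x => (x == g)%:R].

Lemma galg_mul_basel g a x : galg_mul (gbase g) a x = a (g^-1 * x)%g.
Proof.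
rewrite ffunE (bigD1 g) //= ffunE eqxx mul1r big1 ?addr0 // => h hg.
by rewrite ffunE (negPf hg) mul0r.
Qed.

Lemma galg_mul_baser g a x : galg_mul a (gbase g) x = a (x * g^-1)%g.
Proof.
rewrite ffunE (bigD1 (x * g^-1)%g) //= ffunE invMg invgK mulgKV eqxx mulr1.
rewrite big1 ?addr0 // => h hg.
rewrite ffunE -(inj_eq (mulgI h)) mulKVg -(inj_eq (mulIg g^-1%g)) mulgK eq_sym.
by rewrite (negPf hg) mulr0.
Qed.

Lemma galg_mulDl : left_distributive (@galg_mul k gT) +%R.
Proof.
move=> a b c; apply/ffunP=> x; rewrite !ffunE -big_split /=.
by apply: eq_bigr => h _; rewrite ffunE mulrDl.
Qed.

Lemma galg_mulDr : right_distributive (@galg_mul k gT) +%R.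
Proof.
move=> a b c; apply/ffunP=> x; rewrite !ffunE -big_split /=.
by apply: eq_bigr => h _; rewrite ffunE mulrDr.
Qed.

Lemma galg_mul1l : left_id (gbase 1) (@galg_mul k gT).
Proof. by move=> a; apply/ffunP=> x; rewrite galg_mul_basel invg1 mul1g. Qed.

Lemma galg_mul1r : right_id (gbase 1) (@galg_mul k gT).
Proof. by move=> a; apply/ffunP=> x; rewrite galg_mul_baser invg1 mulg1. Qed.

Lemma galg_mulA : associative (@galg_mul k gT).
Proof.
move=> a b c; apply/ffunP=> x; rewrite !ffunE.
transitivity (\sum_h \sum_g a h * (b g * c (g^-1 * (h^-1 * x))%g)).
  by apply: eq_bigr => h _; rewrite ffunE mulr_sumr.
transitivity (\sum_h \sum_g a h * (b (h^-1 * g)%g * c (g^-1 * x)%g)).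
  apply: eq_bigr => h _; rewrite (reindex_inj (mulgI h^-1%g)) /=.
  by apply: eq_bigr => g _; rewrite invMg invgK -!mulgA mulKVg.
rewrite exchange_big /=; apply: eq_bigr => g _; rewrite ffunE mulr_suml.
by apply: eq_bigr => h _; rewrite mulrA.
Qed.

Lemma gbase1_neq0 : gbase 1 != 0.
Proof.
by apply/eqP=> /ffunP/(_ 1%g); rewrite !ffunE eqxx => /eqP; rewrite oner_eq0.
Qed.

End GroupAlgebra.

Fact grpalg_mul_key : unit. Proof. by []. Qed.

(* Unfolding the convolution during unification is prohibitively slow. *)
Definition grpalg_mul (k : fieldType) (gT : finGroupType) :=
  locked_with grpalg_mul_key (@galg_mul k gT).

Lemma grpalg_mulE (k : fieldType) (gT : finGroupType) :
  @grpalg_mul k gT = @galg_mul k gT.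
Proof. exact: unlock. Qed.

Section RingStructure.
Variables (k : fieldType) (gT : finGroupType).
Local Notation mul := (@grpalg_mul k gT).

Lemma grpalg_mulA : associative mul.
Proof. rewrite grpalg_mulE; exact: galg_mulA. Qed.
Lemma grpalg_mul1l : left_id (gbase k (1 : gT)) mul.
Proof. rewrite grpalg_mulE; exact: galg_mul1l. Qed.
Lemma grpalg_mul1r : right_id (gbase k (1 : gT)) mul.
Proof. rewrite grpalg_mulE; exact: galg_mul1r. Qed.
Lemma grpalg_mulDl : left_distributive mul +%R.
Proof. rewrite grpalg_mulE; exact: galg_mulDl. Qed.
Lemma grpalg_mulDr : right_distributive mul +%R.
Proof. rewrite grpalg_mulE; exact: galg_mulDr. Qed.

Lemma grpalg_scalerAl (c : k) (a b : {ffun gT -> k^o}) :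
  c *: mul a b = mul (c *: a) b.
Proof.
rewrite grpalg_mulE; apply/ffunP=> x; rewrite !ffunE scaler_sumr.
by apply: eq_bigr => h _; rewrite ffunE scalerAl.
Qed.

Lemma grpalg_scalerAr (c : k) (a b : {ffun gT -> k^o}) :
  c *: mul a b = mul a (c *: b).
Proof.
rewrite grpalg_mulE; apply/ffunP=> x; rewrite !ffunE scaler_sumr.
by apply: eq_bigr => h _; rewrite ffunE scalerAr.
Qed.

End RingStructure.

(* The bare type {ffun gT -> k^o} is reserved for pointwise structures, so the
   convolution ring lives on the alias [grpalg]. *)
HB.instance Definition _ (k : fieldType) (gT : finGroupType) :=
  GRing.Lmodule.copy (grpalg k gT) {ffun gT -> k^o}.
HB.instance Definition _ (k : fieldType) (gT : finGroupType) :=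
  GRing.Zmodule_isNzRing.Build (grpalg k gT) (@grpalg_mulA k gT)
    (@grpalg_mul1l k gT) (@grpalg_mul1r k gT) (@grpalg_mulDl k gT)
    (@grpalg_mulDr k gT) (gbase1_neq0 k gT).
HB.instance Definition _ (k : fieldType) (gT : finGroupType) :=
  GRing.Lmodule_isLalgebra.Build k (grpalg k gT) (@grpalg_scalerAl k gT).
HB.instance Definition _ (k : fieldType) (gT : finGroupType) :=
  GRing.Lalgebra_isAlgebra.Build k (grpalg k gT) (@grpalg_scalerAr k gT).

(** * Derivations of the group algebra, read on coefficients *)

Section Derivations.
Variables (k : fieldType) (gT : finGroupType).
Local Notation A := (grpalg k gT).
Implicit Types (a b c z : A) (g h x : gT) (D E : A -> A).

Definition gb g : A := gbase k g.

Lemma mulgE : @GRing.mul A = @galg_mul k gT. Proof. exact: grpalg_mulE. Qed.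

Lemma gbE g x : gb g x = (x == g)%:R. Proof. by rewrite ffunE. Qed.
Lemma gb1 : gb 1 = 1. Proof. by []. Qed.

Lemma gb_mull g a x : (gb g * a : A) x = a (g^-1 * x)%g.
Proof. by rewrite -galg_mul_basel -grpalg_mulE. Qed.

Lemma gb_mulr g a x : (a * gb g : A) x = a (x * g^-1)%g.
Proof. by rewrite -galg_mul_baser -grpalg_mulE. Qed.

Lemma gbM g h : gb (g * h) = gb g * gb h.
Proof. by apply/ffunP=> x; rewrite gb_mulr !gbE -(inj_eq (mulIg h^-1%g)) mulgK. Qed.

Lemma gbV g : gb g * gb g^-1%g = 1.
Proof. by rewrite -gbM mulgV. Qed.

Lemma gbVl g : gb g^-1%g * gb g = 1.
Proof. by rewrite -gbM mulVg. Qed.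

Lemma gbX g n : gb (g ^+ n) = gb g ^+ n.
Proof. by elim: n => // n IH; rewrite expgS exprS gbM IH. Qed.

Lemma galgD a b x : (a + b : A) x = a x + b x. Proof. by rewrite ffunE. Qed.
Lemma galgN a x : (- a : A) x = - a x. Proof. by rewrite ffunE. Qed.
Lemma galgB a b x : (a - b : A) x = a x - b x. Proof. by rewrite !ffunE. Qed.
Lemma galg0 x : (0 : A) x = 0. Proof. by rewrite ffunE. Qed.
Lemma galgZ (c : k) a x : (c *: a : A) x = c * a x. Proof. by rewrite ffunE. Qed.
Lemma galg_sumE (I : Type) (r : seq I) (Q : pred I) (F : I -> A) x :
  (\sum_(i <- r | Q i) F i) x = \sum_(i <- r | Q i) F i x.
Proof.
elim/big_rec2: _ => [|i y z _ <-]; first by rewrite galg0.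
by rewrite galgD.
Qed.

Lemma galg_basis a : a = \sum_g a g *: gb g.
Proof.
apply/ffunP=> x; rewrite galg_sumE (bigD1 x) //= galgZ gbE eqxx mulr1.
by rewrite big1 ?addr0 // => g gx; rewrite galgZ gbE eq_sym (negPf gx) mulr0.
Qed.

Definition lin D := (forall a b, D (a + b) = D a + D b) /\
  (forall (c : k) a, D (c *: a) = c *: D a).

Lemma lin0 D : lin D -> D 0 = 0.
Proof. by case=> _ DZ; rewrite -[X in D X](scale0r (0 : A)) DZ scale0r. Qed.

Lemma linN D a : lin D -> D (- a) = - D a.
Proof. by case=> _ DZ; rewrite -scaleN1r DZ scaleN1r. Qed.

Lemma linB D a b : lin D -> D (a - b) = D a - D b.
Proof. by move=> lD; rewrite (proj1 lD) linN. Qed.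

Lemma lin_sum D (I : Type) (r : seq I) (Q : pred I) (F : I -> A) :
  lin D -> D (\sum_(i <- r | Q i) F i) = \sum_(i <- r | Q i) D (F i).
Proof.
move=> lD; elim/big_rec2: _ => [|i y z _ <-]; first exact: lin0.
by rewrite (proj1 lD).
Qed.

Lemma lin_ext D E : lin D -> lin E -> (forall g, D (gb g) = E (gb g)) -> D =1 E.
Proof.
move=> lD lE DE a; rewrite (galg_basis a) !lin_sum //; apply: eq_bigr => g _.
by rewrite (proj2 lD) (proj2 lE) DE.
Qed.

Local Notation der := (@is_der k A *%R).
Local Notation inner := (@is_inner k A *%R).

Lemma der_lin D : der D -> lin D. Proof. by case. Qed.

Lemma derM D : der D -> forall a b, D (a * b) = D a * b + a * D b.
Proof. by case. Qed.

Lemma der1 D : der D -> D 1 = 0.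
Proof.
move=> dD; have := derM dD 1 1; rewrite !mulr1 mul1r.
by rewrite -[LHS]addr0 => /addrI.
Qed.

Lemma derP D : lin D ->
  (forall g h, D (gb g * gb h) = D (gb g) * gb h + gb g * D (gb h)) -> der D.
Proof.
move=> lD DM; split; [exact: proj1 lD | exact: proj2 lD | ] => a b.
have lr c : lin (fun a => a * c) by split=> *; rewrite ?mulrDl ?scalerAl.
have ll c : lin (fun a => c * a) by split=> *; rewrite ?mulrDr ?scalerAr.
have H g : forall b, D (gb g * b) = D (gb g) * b + gb g * D b.
  apply: lin_ext => [||h]; last exact: DM.
    by split=> *; rewrite ?mulrDr -?scalerAr (proj1 lD, proj2 lD).
  split=> [x y|c x]; first by rewrite (proj1 lD) !mulrDr addrACA.
  by rewrite (proj2 lD) -!scalerAr scalerDr.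
have := @lin_ext (fun a => D (a * b)) (fun a => D a * b + a * D b).
move=> -> //.
  by split=> *; rewrite ?mulrDl -?scalerAl (proj1 lD, proj2 lD).
split=> [x y|c x]; first by rewrite (proj1 lD) !mulrDl addrACA.
by rewrite (proj2 lD) -!scalerAl scalerDr.
Qed.

Lemma ad_der z : der (fun a => z * a - a * z).
Proof.
split=> [a b|c a|a b].
- by rewrite mulrDr mulrDl opprD addrACA.
- by rewrite -scalerAr -scalerAl scalerBr.
by rewrite mulrBl mulrBr !mulrA addrA subrK.
Qed.

Lemma inner_der D : inner D -> der D.
Proof.
case=> z zD; have [dD dZ dM] := ad_der z.
by split=> *; rewrite !zD; [apply: dD | apply: dZ | apply: dM].
Qed.

Lemma inner_ext D E : D =1 E -> inner D -> inner E.
Proof. by move=> DE [z zD]; exists z => a; rewrite -DE. Qed.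

Lemma inner0 : inner (fun _ => 0).
Proof. by exists 0 => a; rewrite mul0r mulr0 subrr. Qed.

Lemma innerD D E : inner D -> inner E -> inner (fun a => D a + E a).
Proof.
move=> [z zD] [w wE]; exists (z + w) => a; rewrite zD wE.
by rewrite mulrDl mulrDr opprD addrACA.
Qed.

Lemma innerZ (c : k) D : inner D -> inner (fun a => c *: D a).
Proof.
move=> [z zD]; exists (c *: z) => a; rewrite zD.
by rewrite -scalerAl -scalerAr scalerBr.
Qed.

Lemma derD D E : der D -> der E -> der (fun a => D a + E a).
Proof.
move=> [D1 D2 D3] [E1 E2 E3]; split=> [a b|c a|a b].
- by rewrite D1 E1 addrACA.
- by rewrite D2 E2 scalerDr.
by rewrite D3 E3 mulrDl mulrDr addrACA.
Qed.

Lemma derZ (c : k) D : der D -> der (fun a => c *: D a).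
Proof.
move=> [D1 D2 D3]; split=> [a b|c' a|a b].
- by rewrite D1 scalerDr.
- by rewrite D2 !scalerA mulrC.
by rewrite D3 scalerDr scalerAl scalerAr.
Qed.

Lemma derB D E : der D -> der E -> der (fun a => D a - E a).
Proof.
move=> dD dE; have [H1 H2 H3] := derD dD (derZ (-1) dE).
by split=> *; rewrite -!scaleN1r; [apply: H1 | apply: H2 | apply: H3].
Qed.

Lemma der_lbr D E : der D -> der E -> der (lbr D E).
Proof.
move=> [D1 D2 D3] [E1 E2 E3]; rewrite /lbr; split=> [a b|c a|a b].
- by rewrite !(D1, E1) opprD addrACA.
- by rewrite !(D2, E2) scalerBr.
rewrite !(D3, E3, D1, E1) mulrBl mulrBr.
have e (x y z : A) : (x + z) - (y + z) = x - y.
  by rewrite opprD addrACA subrr addr0.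
rewrite [X in _ - X]addrACA opprD addrACA e.
by rewrite !(addrC (D a * E b)) e.
Qed.

Lemma lbr_inner D z : der D -> forall a,
  lbr (fun a => z * a - a * z) D a = - (D z * a - a * D z).
Proof.
move=> dD a; rewrite /lbr (linB _ _ (der_lin dD)) !(derM dD).
rewrite [D a * z + _]addrC [in X in _ - X]opprD addrACA.
have e (x y : A) : x - (y + x) = - y by rewrite opprD addrCA subrr addr0.
by rewrite e.
Qed.

(** Bracketing with D sends ad z to ad (D z). *)
Lemma inner_lbr D E : der D -> inner E -> inner (lbr D E).
Proof.
move=> dD [z zE]; exists (D z) => a; have /eqP := lbr_inner z dD a.
rewrite -eqr_oppLR /lbr opprB => /eqP <-.
by rewrite !zE.
Qed.

(** Both products have coefficient z(x) there, so these coefficients depend only on the class of a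
    derivation modulo inner ones. *)
Lemma ad_eq0 z g x : commute x g -> (z * gb g - gb g * z) (x * g)%g = 0.
Proof. by move=> cxg; rewrite galgB gb_mulr gb_mull mulgK cxg mulKg subrr. Qed.

Lemma inner_eq0 D g x : inner D -> commute x g -> D (gb g) (x * g)%g = 0.
Proof. by case=> z zD cxg; rewrite zD ad_eq0. Qed.

(** This is the crossed homomorphism identity for g |-> D(g) g^-1, with G acting on kG by
    conjugation, read at x. *)
Lemma der_coefM D g h x : der D ->
  D (gb (g * h)) (x * (g * h))%g = D (gb g) (x * g)%g + D (gb h) (x ^ g * h)%g.
Proof.
move=> dD; rewrite gbM (derM dD) galgD gb_mulr gb_mull.
by rewrite mulgA mulgK conjgE !mulgA.
Qed.

(* H^1(G, kG) for the conjugation module splits over conjugacy classes; the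
   summand of x is Hom(C(x), k) by Shapiro's lemma, through the coefficients
   below. *)
Lemma inner_of_coef D : der D ->
  (forall x g, commute x g -> D (gb g) (x * g)%g = 0) -> inner D.
Proof.
move=> dD D0; pose r y := repr (y ^: [set: gT])%g.
(* [t y] carries y to the representative of its class; by [tP] the default 1 does no harm. *)
pose t y := odflt 1%g [pick t | (y ^ t == r y)%g].
have tP y : (y ^ t y)%g = r y.
  rewrite /t; case: pickP => [u /eqP//|nt].
  have /imsetP[u _ ru] : r y \in (y ^: [set: gT])%g by apply/mem_repr/class_refl.
  by have := nt u; rewrite ru eqxx.
have rJ y g : r (y ^ g)%g = r y by rewrite /r classGidl // inE.
pose z : A := [ffun y => D (gb (t y)) (y * t y)%g].
exists z => a; have [Dl Al] := (der_lin dD, der_lin (ad_der z)).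
apply: (lin_ext Dl Al) a => g; apply/ffunP=> x.
rewrite -(mulgKV g x); move: (x * g^-1)%g => y.
rewrite galgB gb_mulr gb_mull mulgK !ffunE.
set y' := (g^-1 * (y * g))%g; have y'E : y' = (y ^ g)%g by rewrite conjgE.
(* The loop [h] fixes [r y], so [D0] kills its contribution; this compares the paths starting at y
   and at y ^ g. *)
pose h := ((t y)^-1 * (g * t y'))%g.
have := der_coefM g (t y') y dD; have := der_coefM (t y) h y dD.
rewrite {1 2}/h mulKVg tP (D0 _ h) ?addr0 => [->|].
  by rewrite -y'E => ->; rewrite addrK.
apply/commgP/conjg_fixP.
by rewrite -{1}(tP y) /h -conjgM mulKVg conjgM -y'E tP y'E rJ.
Qed.

(** On the centraliser of x the crossed homomorphism is an ordinary homomorphism to the additive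
    group of k. *)
Lemma der_coefX D g x n : der D -> commute x g ->
  D (gb (g ^+ n)%g) (x * g ^+ n)%g = D (gb g) (x * g)%g *+ n.
Proof.
move=> dD cxg; elim: n => [|n IH].
  by rewrite expg0 gb1 (der1 dD) galg0.
by rewrite expgS der_coefM // mulrS conjgE cxg mulKg -cxg IH.
Qed.

(** Differentiating f f = f gives D f = 2 f D f; multiplying by f forces f D f = 0. *)
Lemma der_idem0 D (f : A) : der D -> f * f = f -> (forall a, f * a = a * f) ->
  D f = 0.
Proof.
move=> dD ff fC; have De : D f = f * D f *+ 2.
  by rewrite -[in LHS]ff (derM dD) -fC mulr2n.
have fDf : f * D f = 0.
  have : f * D f = f * D f + f * D f.
    by rewrite [in LHS]De mulrnAr mulrA ff mulr2n.
  by rewrite -[LHS]addr0 => /addrI.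
by rewrite De fDf mul0rn.
Qed.

(** A homomorphism from the centraliser of x to k kills elements of order prime to p, so the p-part
    of g decides. *)
Lemma inner_of_pcoef D p : p \in [pchar k] -> der D ->
  (forall x v, (p.-elt v)%g -> commute x v -> D (gb v) (x * v)%g = 0) -> inner D.
Proof.
move=> pk dD D0; apply: inner_of_coef => // x g cxg.
rewrite -(consttC p g) der_coefM //.
have cn n : commute x (g ^+ n)%g by apply: commuteX.
have [n En] : exists n, (g.`_p = g ^+ n)%g by apply/cycleP/mem_cycle.
have [m Em] : exists m, (g.`_p^' = g ^+ m)%g by apply/cycleP/mem_cycle.
rewrite D0 ?p_elt_constt ?En ?add0r // conjgE cn mulKg.
have: commute x g.`_p^'%g by rewrite Em.
have := p_elt_constt p^' g; move: (g.`_p^')%g => y y_p' cxy.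
have := der_coefX #[y]%g dD cxy; rewrite expg_order gb1 (der1 dD) galg0.
move/esym/eqP; rewrite -mulr_natr mulf_eq0 => /orP[/eqP //|].
rewrite -(dvdn_pcharf pk) => py; have p_pr := pcharf_prime pk.
have: ~~ (p %| #[y]%g)%N by rewrite -p'natE.
by rewrite py.
Qed.

End Derivations.

(** * Derivations of k[X]/(X^p) *)

Section Truncated.
Variables (k : fieldType) (p : nat).
Local Notation T := {ffun 'I_p -> k^o}.
Local Notation tmul := (@trunc_mul k p).
Implicit Types (F G S : {poly k}) (t s : T).

(** Reduction modulo X^p; [rpoly] is its section by polynomials of degree below p. *)
Definition tpoly F : T := [ffun i : 'I_p => F`_i].
Definition rpoly t : {poly k} := \sum_(i < p) t i *: 'X^i.

Lemma rpolyK t : tpoly (rpoly t) = t.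
Proof.
apply/ffunP=> i; rewrite ffunE coef_sum (bigD1 i) //= coefZ coefXn eqxx mulr1.
rewrite big1 ?addr0 // => j ji; rewrite coefZ coefXn.
by rewrite -(inj_eq val_inj) eq_sym in ji; rewrite (negPf ji) mulr0.
Qed.

Lemma size_rpoly t : (size (rpoly t) <= p)%N.
Proof.
apply: (leq_trans (size_sum _ _ _)); apply/bigmax_leqP => i _.
by rewrite (leq_trans (size_scale_leq _ _)) // size_polyXn.
Qed.

Lemma tpolyK F : (size F <= p)%N -> rpoly (tpoly F) = F.
Proof.
move=> sF; rewrite -[RHS]coefK (poly_def (size F)) /rpoly.
rewrite (big_ord_widen p (fun i => F`_i *: 'X^i) sF) [RHS]big_mkcond /=.
apply: eq_bigr => i _; rewrite ffunE; case: ifP => // /negbT.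
by rewrite -leqNgt => /(nth_default 0) ->; rewrite scale0r.
Qed.

Lemma tpolyD F G : tpoly (F + G) = tpoly F + tpoly G.
Proof. by apply/ffunP=> i; rewrite !ffunE coefD. Qed.

Lemma tpolyZ (c : k) F : tpoly (c *: F) = c *: tpoly F.
Proof. by apply/ffunP=> i; rewrite !ffunE coefZ. Qed.

Lemma tpoly0 : tpoly 0 = 0.
Proof. by apply/ffunP=> i; rewrite !ffunE coef0. Qed.

Lemma tpoly_eq0 F : (size F <= p)%N -> tpoly F = 0 -> F = 0.
Proof.
move=> sF F0; rewrite -(tpolyK sF) F0 /rpoly big1 // => i _.
by rewrite ffunE scale0r.
Qed.

Lemma tpolyM F G : tpoly (F * G) = tmul (tpoly F) (tpoly G).
Proof.
apply/ffunP=> n; rewrite !ffunE coefM.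
rewrite (big_ord_widen p (fun i => F`_i * G`_(n - i)) (ltn_ord n)) big_mkcond.
apply: eq_bigr => i _; case: ifP => [|/negbT] i_n.
  have ltp : (n - i < p)%N by rewrite (leq_ltn_trans (leq_subr _ _)).
  rewrite (bigD1 (Ordinal ltp)) /= ?subnKC // !ffunE.
  rewrite big1 ?addr0 // => j /andP[/eqP ijn]; rewrite -(inj_eq val_inj) /=.
  by rewrite -ijn addKn eqxx.
rewrite big_pred0 // => j; apply/negP=> /eqP ijn.
by rewrite -ijn ltnS leq_addr in i_n.
Qed.

(** Leibniz along the Horner form F X + c: a derivation with value S at X acts as S d/dX. *)
Lemma tder_poly (d : T -> T) S : is_der tmul d -> d (tpoly 'X) = tpoly S ->
  forall F, d (tpoly F) = tpoly (F^`() * S).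
Proof.
move=> [dD dZ dM] dX.
have d0 : d 0 = 0 by rewrite -[X in d X](scale0r (0 : T)) dZ scale0r.
have d1 : d (tpoly 1) = 0.
  have := dM (tpoly 1) (tpoly 1).
  rewrite -[d (tpoly 1)]rpolyK -!tpolyM !mulr1 mul1r rpolyK.
  by rewrite -[LHS]addr0 => /addrI.
elim/poly_ind => [|F c IH]; first by rewrite tpoly0 d0 deriv0 mul0r tpoly0.
rewrite tpolyD dD -[c%:P]alg_polyC tpolyZ dZ d1 scaler0 addr0 tpolyM dM IH dX.
rewrite -!tpolyM -tpolyD alg_polyC !derivE mulrDl addrC.
by rewrite [F^`() * _ * _]mulrAC.
Qed.

Lemma tder_eq (d e : T -> T) : is_der tmul d -> is_der tmul e ->
  d (tpoly 'X) = e (tpoly 'X) -> d =1 e.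
Proof.
move=> dd de dXe t; rewrite -(rpolyK t).
have eS : e (tpoly 'X) = tpoly (rpoly (e (tpoly 'X))) by rewrite rpolyK.
by rewrite (tder_poly dd (etrans dXe eS)); apply/esym/tder_poly.
Qed.

Definition wder S t : T := tpoly ((rpoly t)^`() * S).

Hypothesis pk : p \in [pchar k].

(** Below X^p, the only coefficient of F' that sees F beyond the truncation is the one at p - 1. It
    is p times a coefficient of F, hence zero. *)
Lemma tpoly_deriv F G : tpoly F = tpoly G -> tpoly F^`() = tpoly G^`().
Proof.
move=> FG; apply/ffunP=> i; rewrite !ffunE !coef_deriv.
have [ip|] := boolP (i.+1 < p)%N.
  have := congr1 (fun t : T => t (Ordinal ip)) FG.
  by rewrite !ffunE /= => ->.
rewrite -leqNgt leq_eqVlt ltnNge ltn_ord orbF => /eqP <-.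
by rewrite -mulr_natr -[in RHS]mulr_natr (pcharf0 pk) !mulr0.
Qed.

Lemma wderE S F : wder S (tpoly F) = tpoly (F^`() * S).
Proof. by rewrite /wder !tpolyM (tpoly_deriv (rpolyK _)). Qed.

Lemma wder_der S : is_der tmul (wder S).
Proof.
split=> [a b|c a|a b]; rewrite -(rpolyK a).
- by rewrite -(rpolyK b) -tpolyD !wderE derivD mulrDl tpolyD.
- by rewrite -tpolyZ !wderE derivZ -scalerAl tpolyZ.
rewrite -(rpolyK b) -tpolyM !wderE -!tpolyM -tpolyD derivM mulrDl.
by rewrite !mulrA [_ * S * _]mulrAC.
Qed.

Lemma wderX S : wder S (tpoly 'X) = tpoly S.
Proof. by rewrite wderE derivX mul1r. Qed.

End Truncated.

(** * Semisimplicity of powers of the Witt algebra *)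

Section WittSemisimple.
Variables (k : fieldType) (gT : finGroupType) (p m : nat).
Local Notation A := (grpalg k gT).
Local Notation T := {ffun 'I_p -> k^o}.
Local Notation tmul := (@trunc_mul k p).
Local Notation der := (@is_der k A *%R).
Local Notation inner := (@is_inner k A *%R).
Hypotheses (pk : p \in [pchar k]) (p2 : p <> 2%N).
Variable phi : (A -> A) -> 'I_m -> T -> T.
Hypotheses
  (phi_der : forall D, der D -> forall i, is_der tmul (phi D i))
  (phiZ : forall (c : k) D, der D ->
     forall i x, phi (fun a => c *: D a) i x = c *: phi D i x)
  (phi_lbr : forall D E, der D -> der E ->
     forall i x, phi (lbr D E) i x = lbr (phi D i) (phi E i) x)
  (phi_onto : forall F : 'I_m -> T -> T, (forall i, is_der tmul (F i)) ->
     exists D, der D /\ forall i x, phi D i x = F i x)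
  (phi_ker : forall D, der D -> ((forall i x, phi D i x = 0) <-> inner D)).

(** Modulo inner derivations, D is the field S d/dX in the i-th Witt factor. *)
Definition concentrated i (S : {poly k}) (D : A -> A) :=
  [/\ der D, forall j x, j != i -> phi D j x = 0 & phi D i =1 wder S].

Lemma concentrated_ex i S : exists D, concentrated i S D.
Proof.
pose F j := if j == i then @wder k p S else wder 0.
have [j|D [dD DF]] := @phi_onto F.
  by rewrite /F; case: ifP => _; apply: wder_der.
exists D; split=> // [j x /negPf ji|x]; rewrite DF /F ?eqxx ?ji //.
by rewrite /wder mulr0 tpoly0.
Qed.

Lemma concentratedZ i S D c :
  concentrated i S D -> concentrated i (c *: S) (fun a => c *: D a).
Proof.
move=> [dD Dj Di]; split; first exact: derZ.
  by move=> j x ji; rewrite phiZ // Dj ?scaler0.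
by move=> x; rewrite phiZ // Di /wder -tpolyZ scalerAr.
Qed.

Lemma tder0 (d : T -> T) : is_der tmul d -> d 0 = 0.
Proof. by case=> _ dZ _; rewrite -[X in d X](scale0r (0 : T)) dZ scale0r. Qed.

(** The bracket of S d/dX and R d/dX is (R' S - S' R) d/dX; in the other factors D is zero, so E is
    free there. *)
Lemma concentrated_lbr i S R D E :
  concentrated i S D -> der E -> phi E i (tpoly p 'X) = tpoly p R ->
  concentrated i (R^`() * S - S^`() * R) (lbr D E).
Proof.
move=> [dD Dj Di] dE ER; split; first exact: der_lbr.
  by move=> j x ji; rewrite phi_lbr // /lbr !Dj // tder0 ?subrr //; apply: phi_der.
apply: tder_eq; [exact/phi_der/der_lbr | exact: wder_der | ].
rewrite phi_lbr // /lbr ER !Di !wderE // derivX !mul1r.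
rewrite (tder_poly (phi_der dE i) ER).
by rewrite -[- tpoly _ _]scaleN1r -tpolyZ -tpolyD scaleN1r.
Qed.

Lemma concentratedX i S D :
  concentrated i S D -> phi D i (tpoly p 'X) = tpoly p S.
Proof. by case=> _ _ ->; rewrite wderX. Qed.

Lemma concentrated_der i S D : concentrated i S D -> der D.
Proof. by case. Qed.

Lemma natr_neq0 n : (0 < n < p)%N -> n%:R != 0 :> k.
Proof.
case/andP=> n0 np; rewrite -(dvdn_pcharf pk); apply/negP=> /(dvdn_leq n0).
by rewrite leqNgt np.
Qed.

Section Ideal.
Variable J : (A -> A) -> Prop.
Hypotheses (idJ : @der_ideal k A *%R J).

(* Bracketing with d/dX lowers the degree of the i-th component; the last step,
   with X d/dX, isolates that component. *)
Lemma ideal_concentrated1 i D R n : J D -> phi D i (tpoly p 'X) = tpoly p R ->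
  size R = n.+1 -> (n < p)%N -> exists2 E, J E & concentrated i 1 E.
Proof.
have [[_ _ JZ] Jder Jlbr] := idJ.
elim: n D R => [|n IH] D R JD DR sR np.
  have [L cL] := concentrated_ex i 'X.
  have cLD := concentrated_lbr cL (Jder _ JD) DR.
  have dL := concentrated_der cL.
  (* With R a constant c, the bracket of X d/dX with D is -c d/dX, whence the scalar. *)
  exists (fun a => - (R`_0)^-1 *: lbr L D a); first by apply/JZ/Jlbr.
  have := concentratedZ (- (R`_0)^-1) cLD.
  have RC : R = (R`_0)%:P by apply: size1_polyC; rewrite sR.
  rewrite {2 3}RC derivX derivC mul0r mul1r sub0r scaleNr scalerN opprK.
  rewrite -mul_polyC. rewrite -polyCM mulVf //.
  by rewrite -(polyC_eq0 (R`_0)) -RC -size_poly_gt0 sR.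
have [L cL] := concentrated_ex i 1.
have cLD := concentrated_lbr cL (Jder _ JD) DR.
have := concentratedX cLD; rewrite mulr1 derivC mul0r subr0 => LDR.
apply: IH LDR _ (ltnW np); first exact/Jlbr/JD/(concentrated_der cL).
(* The degree drops by exactly one: the top coefficient is multiplied by [n.+1], which is invertible
   because it is below p. *)
have R1 : R^`()`_n != 0.
  rewrite coef_deriv -mulr_natr mulf_neq0 ?natr_neq0 //.
  by have := lead_coef_eq0 R; rewrite lead_coefE -size_poly_eq0 sR /= => ->.
apply/eqP; rewrite eqn_leq -ltnS -sR lt_size_deriv -?size_poly_gt0 ?sR //=.
by rewrite ltnNge; apply: contra R1 => /(nth_default 0) ->.
Qed.

Lemma natr2_neq0 : 2%:R != 0 :> k.
Proof.
apply: natr_neq0; rewrite /= ltn_neqAle prime_gt1 ?(pcharf_prime pk) // andbT.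
by apply/eqP=> /esym.
Qed.

(* The elements d/dX, X d/dX, X^2 d/dX of the i-th component: they span a copy
   of sl_2, which is perfect because p <> 2. *)
Definition sl2_in i (S : (A -> A) -> Prop) := forall n, (n < 3)%N ->
  exists2 E, S E & concentrated i 'X^n E.

(** The ideal contains d/dX. Bracketing X^2 d/dX with it gives -2 X d/dX, and with X d/dX gives -X^2
    d/dX; 2 is invertible. *)
Lemma sl2_in_ideal i D : J D -> phi D i (tpoly p 'X) != 0 -> sl2_in i J.
Proof.
have [[_ _ JZ] Jder Jlbr] := idJ.
move=> JD D0; set R := rpoly (phi D i (tpoly p 'X)).
have DR : phi D i (tpoly p 'X) = tpoly p R by rewrite rpolyK.
have R0 : R != 0 by apply: contraNneq D0 => R0; rewrite DR R0 tpoly0.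
have [||E0 JE0 cE0] := ideal_concentrated1 (n := (size R).-1) JD DR.
- by rewrite prednK // size_poly_gt0.
- by rewrite prednK ?size_poly_gt0 // size_rpoly.
have [L cL] := concentrated_ex i 'X^2; have dL := concentrated_der cL.
have := concentrated_lbr cL (Jder _ JE0) (concentratedX cE0).
move/(concentratedZ (- (2%:R)^-1)).
rewrite derivC mul0r derivXn expr1 mulr1 sub0r scalerN scaleNr opprK.
rewrite -(scaler_nat 2 'X) scalerA mulVf ?natr2_neq0 // scale1r => cE1.
have JE1 := JZ (- (2%:R)^-1) _ (Jlbr _ _ dL JE0).
have := concentrated_lbr cL (Jder _ JE1) (concentratedX cE1).
move/(concentratedZ (- 1)); rewrite derivX derivXn expr1 mul1r mulr2n mulrDl.
rewrite -expr2 opprD addNKr scaleN1r opprK => cE2.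
have JE2 := JZ (- 1) _ (Jlbr _ _ dL JE1).
case=> [|[|[|//]]] _; [exact: (ex_intro2 _ _ _ JE0 cE0) | | ].
  exact: (ex_intro2 _ _ _ JE1 cE1).
exact: (ex_intro2 _ _ _ JE2 cE2).
Qed.

End Ideal.

Lemma brspan_lbr (S : (A -> A) -> Prop) (c : k) D E : S D -> S E ->
  brspan S S (fun a => c *: lbr D E a).
Proof.
move=> SD SE; exists 1%N, (fun _ => c), (fun _ => D), (fun _ => E).
by split=> //; split=> //; apply: functional_extensionality => a; rewrite big_ord1.
Qed.

(** Up to invertible scalars each of the three fields is a bracket of two of them, so the triple
    survives in every derived term. *)
Lemma sl2_in_dser i J n : (sl2_in i J) ->
  sl2_in i (dser_mod J (@Inn k A *%R) n).
Proof.
move=> J3; elim: n => //= n IH.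
have step (u v : nat) (c : k) : (u < 3)%N -> (v < 3)%N ->
    exists2 E, dser_mod J (@Inn k A *%R) n.+1 E &
      concentrated i (c *: (('X^v)^`() * 'X^u - ('X^u)^`() * 'X^v)) E.
  move=> /IH[D SD cD] /IH[E SE cE].
  exists (fun a => c *: lbr D E a).
    exists (fun a => c *: lbr D E a), (fun _ => 0); split; first exact: brspan_lbr.
    split; last by apply: functional_extensionality => a; rewrite addr0.
    split; last exact: inner0.
    by split=> *; rewrite ?addr0 ?scaler0 ?mul0r ?mulr0 ?addr0.
  apply: concentratedZ; apply: concentrated_lbr cD _ _.
    exact: concentrated_der cE.
  exact: concentratedX cE.
case=> [|[|[|//]]] _.
- have := step 1%N 0%N (-1) isT isT.
  by rewrite expr0 expr1 derivC derivX mul0r mulr1 sub0r scaleN1r opprK.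
- have := step 2%N 0%N (- (2%:R)^-1) isT isT.
  rewrite expr0 derivC mul0r derivXn expr1 mulr1 sub0r scalerN scaleNr opprK.
  by rewrite -(scaler_nat 2 'X) scalerA mulVf ?natr2_neq0 // scale1r.
have := step 2%N 1%N (-1) isT isT.
rewrite expr1 derivX derivXn expr1 mul1r mulr2n mulrDl.
by rewrite -expr2 opprD addNKr scaleN1r opprK.
Qed.

(** A nonzero component of D would put d/dX in every derived term, hence among the inner
    derivations, where [phi] vanishes. *)
Lemma witt_H1_semisimple : @H1_semisimple k A *%R.
Proof.
move=> J idJ _ [n Jn] D JD.
have [_ Jder _] := idJ; have dD := Jder _ JD.
split=> //; apply/(phi_ker dD) => i.
have [D0|D0] := eqVneq (phi D i (tpoly p 'X)) 0.
  move=> x; rewrite (tder_eq (phi_der dD i) (wder_der pk 0)).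
    by rewrite /wder mulr0 tpoly0.
  by rewrite D0 wderX // tpoly0.
have [E /Jn[dE /(phi_ker dE) E0] /concentratedX] :=
  sl2_in_dser n (sl2_in_ideal idJ JD D0) (isT : (0 < 3)%N).
rewrite E0 expr0 => /esym/tpoly_eq0 /eqP; rewrite oner_eq0 => H.
by case: (notF (H _)); rewrite size_poly1 prime_gt0 ?(pcharf_prime pk).
Qed.

End WittSemisimple.

(** * A normal cyclic Sylow subgroup *)

Section TwistedLeibniz.
Variables (k : fieldType) (R : algType k) (ev : {poly k} -> R) (U e : R).
Variable delta : R -> R.
Implicit Types (F G : {poly k}) (a b : R).

(** Leibniz is assumed only against the left factor U; it follows that [delta] acts on polynomials
    in U as the Euler operator X d/dX. *)
Lemma twisted_leibniz :
  (forall a b, delta (a + b) = delta a + delta b) ->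
  (forall (c : k) a, delta (c *: a) = c *: delta a) ->
  (forall b, delta (U * b) = U * b + U * delta b) ->
  ev 0 = 0 -> ev 'X = U -> (forall c, ev c%:P = c%:A) ->
  (forall F G, ev (F + G) = ev F + ev G) ->
  (forall F G, ev (F * G) = ev F * ev G) ->
  forall F b, delta (ev F * b) = ev ('X * F^`()) * b + ev F * delta b.
Proof.
move=> dD dZ dU ev0 evX evC evD evM; elim/poly_ind => [|F c IH] b.
  have d0 : delta 0 = 0 by rewrite -[X in delta X](scale0r (0 : R)) dZ scale0r.
  by rewrite deriv0 mulr0 ev0 !mul0r add0r.
have evFc b' : ev (F * 'X + c%:P) * b' = ev F * (U * b') + c *: b'.
  by rewrite evD evM evX evC mulrDl -!mulrA -scalerAl mul1r.
have -> : 'X * (F * 'X + c%:P)^`() = 'X * F^`() * 'X + F * 'X.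
  by rewrite !derivE; ring.
rewrite !evFc dD dZ IH dU (evD _ (F * 'X)) (evM _ 'X) (evM F) evX.
by rewrite mulrDr mulrDl -!mulrA -!addrA.
Qed.

Hypotheses (eC : forall a, a * e = e * a) (ee : e * e = e).

Lemma idem_absorb a b : e * (a * e * b) = a * e * b.
Proof. by rewrite !mulrA -eC -(mulrA a) ee. Qed.

Lemma idem_move a b : a * e * (e * b) = e * (a * e * b).
Proof. by rewrite idem_absorb mulrA -(mulrA a) ee. Qed.

(** A composite has a first-order part with coefficient F X G' and a second-order part with
    coefficient F G; the latter is symmetric and cancels. *)
Lemma twisted_bracket :
  (forall F b, delta (ev F * b) = ev ('X * F^`()) * b + ev F * delta b) ->
  (forall b, delta (e * b) = e * delta b) ->
  (forall F G, ev (F * G) = ev F * ev G) ->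
  (forall F G, ev (F - G) = ev F - ev G) ->
  forall F G a,
  ev F * e * delta (ev G * e * delta a) - ev G * e * delta (ev F * e * delta a)
  = ev ('X * (F * G^`() - G * F^`())) * e * delta a.
Proof.
move=> dev de evM evB F G a.
have comp F1 G1 : ev F1 * e * delta (ev G1 * e * delta a) =
    ev (F1 * ('X * G1^`())) * e * delta a + ev (F1 * G1) * e * delta (delta a).
  have eK (b c d : R) : b * e * (c * (e * d)) = b * c * e * d.
    by rewrite !mulrA -(mulrA b) -eC mulrA -(mulrA _ e e) ee.
  by rewrite -(mulrA (ev G1)) dev de mulrDr !eK (evM F1) (evM F1 G1).
rewrite !comp [G * F]mulrC opprD addrACA subrr addr0 -!mulrBl -evB.
by congr (ev _ * _ * _); ring.
Qed.

End TwistedLeibniz.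

(** * Logarithm, twisting character and crossed homomorphism *)

Section NormalCyclicSylow.
Variables (k : fieldType) (gT : finGroupType) (p : nat) (P E : {group gT}) (u : gT).
Hypotheses (pk : p \in [pchar k]) (sylP : (p.-Sylow([set: gT]) P)%g)
  (defG : (P ><| E)%g = [set: gT]) (Pu : (P :=: <[u]>)%g) (u1 : u != 1%g).
Local Notation A := (grpalg k gT).
Local Notation der := (@is_der k A *%R).
Local Notation inner := (@is_inner k A *%R).
Local Notation gb := (@gb k gT).
Local Notation N := #[u]%g.
Implicit Types (g h x y v w : gT) (F : {poly k}).

Lemma p_prime : prime p. Proof. exact: pcharf_prime pk. Qed.

Lemma sdP : [/\ (P * E)%g = [set: gT], E \subset ('N(P))%g & (P :&: E = 1)%g].
Proof. by case/sdprodP: defG. Qed.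

Lemma mem_u : u \in P. Proof. by rewrite Pu cycle_id. Qed.

Lemma P_pgroup : (p.-group P)%g. Proof. exact: pHall_pgroup sylP. Qed.

Lemma dvdn_pN : (p %| N)%N.
Proof.
have := P_pgroup; rewrite Pu => /pgroup_pdiv[|_ //].
by rewrite cycle_eq1.
Qed.

Lemma N_gt0 : (0 < N)%N. Proof. exact: order_gt0. Qed.

Lemma P_norm g : g \in ('N(P))%g.
Proof.
have [PE nPE _] := sdP; have : g \in (P * E)%g by rewrite PE inE.
by apply/subsetP; rewrite mul_subG ?normG.
Qed.

Lemma P_abelian : abelian P.
Proof. by rewrite Pu cycle_abelian. Qed.

Lemma memPX v : v \in P -> exists i, v = (u ^+ i)%g.
Proof. by rewrite Pu => /cycleP. Qed.

Lemma expu_P i : (u ^+ i)%g \in P.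
Proof. by rewrite groupX ?mem_u. Qed.

Lemma memPJ v g : ((v ^ g)%g \in P) = (v \in P).
Proof. by rewrite memJ_norm ?P_norm. Qed.

(** The discrete logarithm to base u, reduced to k; the reduction is additive because p divides the
    order of u. The default 0 concerns elements outside P. *)
Definition lg v : k := if [pick i : 'I_N | (u ^+ i == v)%g] is Some i then i%:R else 0.

Lemma natr_N i : (i %% N)%N%:R = i%:R :> k.
Proof.
have N0 : N%:R = 0 :> k by apply/eqP; rewrite -(dvdn_pcharf pk) dvdn_pN.
by rewrite [in RHS](divn_eq i N) natrD natrM N0 mulr0 add0r.
Qed.

Lemma lgX i : lg (u ^+ i)%g = i%:R.
Proof.
rewrite /lg; case: pickP => [j /eqP/eqP|/(_ (Ordinal (ltn_pmod i N_gt0)))].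
  by rewrite eq_expg_mod_order => /eqP e; rewrite -natr_N e natr_N.
by rewrite /= expg_mod_order eqxx.
Qed.

Lemma lgu : lg u = 1. Proof. exact: lgX 1%N. Qed.

Lemma lgM v w : v \in P -> w \in P -> lg (v * w)%g = lg v + lg w.
Proof. by move=> /memPX[i ->] /memPX[j ->]; rewrite -expgD !lgX natrD. Qed.

(** The exponent, read in k, of g u g^-1 as a power of u. *)
Definition chi g := lg (u ^ g^-1)%g.

Lemma lgJ v g : v \in P -> lg (v ^ g^-1)%g = chi g * lg v.
Proof.
move=> /memPX[i ->]; rewrite conjXg /chi.
have /memPX[s ->] : (u ^ g^-1)%g \in P by rewrite memPJ mem_u.
by rewrite -expgM !lgX natrM.
Qed.

Lemma chiM g h : chi (g * h)%g = chi g * chi h.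
Proof.
rewrite {1}/chi invMg conjgM lgJ //.
by rewrite memPJ mem_u.
Qed.

Lemma chi_cent x : x \in 'C(P)%g -> chi x = 1.
Proof.
move=> cxP; rewrite /chi; have -> : (u ^ x^-1 = u)%g; last exact: lgu.
by rewrite conjgE invgK mulgA (centP cxP) ?mem_u // mulgK.
Qed.

Lemma chi1 : chi 1%g = 1. Proof. by rewrite chi_cent ?group1. Qed.

Lemma chiV g : chi g * chi g^-1%g = 1.
Proof. by rewrite -chiM mulgV chi1. Qed.

Lemma chi_neq0 g : chi g != 0.
Proof.
by apply/eqP=> g0; have := chiV g; rewrite g0 mul0r => /esym/eqP; rewrite oner_eq0.
Qed.

Lemma P_cent v : v \in P -> v \in 'C(P)%g.
Proof. by move/(subsetP P_abelian). Qed.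

Definition ell g := lg (divgr P E g).

Lemma memPE g : g \in (P * E)%g. Proof. by case: sdP => -> _ _; rewrite inE. Qed.

Lemma memPE_split g : exists v e, [/\ v \in P, e \in E & g = (v * e)%g].
Proof.
exists (divgr P E g), (remgr P E g).
by rewrite mem_divgr ?memPE // mem_remgr ?memPE // -divgr_eq.
Qed.

Lemma ell_mid v e : v \in P -> e \in E -> ell (v * e)%g = lg v.
Proof. by move=> Pv Ee; case: sdP => _ _ tiPE; rewrite /ell divgrMid. Qed.

(** Collecting the P-factors of v e w f moves w past e, which multiplies its logarithm by
    [chi e]. *)
Lemma ellM g h : ell (g * h)%g = ell g + chi g * ell h.
Proof.
have [v [e [Pv Ee ->]]] := memPE_split g.
have [w [f [Pw Ef ->]]] := memPE_split h.
have -> : (v * e * (w * f) = v * w ^ e^-1 * (e * f))%g.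
  by rewrite conjgE invgK !mulgA mulgKV.
have Pwe : (w ^ e^-1)%g \in P by rewrite memPJ.
have Pvw := groupM Pv Pwe; have Eef := groupM Ee Ef.
rewrite !ell_mid // lgM // lgJ //.
by rewrite chiM (chi_cent (P_cent Pv)) mul1r.
Qed.

Lemma ell_P v : v \in P -> ell v = lg v.
Proof. by move=> Pv; rewrite /ell divgr_id. Qed.

Lemma ell_E h : h \in E -> ell h = 0.
Proof.
have [_ _ tiPE] := sdP.
by move=> Eh; rewrite /ell -[h]mul1g divgrMid // (lgX 0).
Qed.

(* For the p'-part y of x, [P, y] meets C_P(y) trivially, whereas two nontrivial
   subgroups of a cyclic p-group share its subgroup of order p. *)
Lemma cent_of_commute v x : v \in P -> v != 1%g -> commute x v -> x \in 'C(P)%g.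
Proof.
move=> Pv v1 cxv; rewrite -(consttC p x) groupM //.
  apply/P_cent; rewrite (mem_normal_Hall sylP) ?inE ?p_elt_constt //.
  by apply/normalP; split=> [|g _]; [exact: subsetT | exact/normP/P_norm].
set y := (x.`_p^')%g.
have cyv : commute y v by apply/commute_sym/commuteX/commute_sym.
have nPy : <[y]>%g \subset 'N(P)%g by rewrite cycle_subG P_norm.
have coPy : coprime #|P| #|<[y]>%g|.
  by rewrite (pnat_coprime P_pgroup) //; apply: p_elt_constt.
have tiC := coprime_abel_cent_TI nPy coPy P_abelian.
have sRP : ([~: P, <[y]>] \subset P)%g by rewrite commg_subl.
have [R1|ntR] := eqVneq [~: P, <[y]>]%G 1%G.
  have /commG1P : ([~: P, <[y]>] = 1)%g by rewrite [LHS](congr1 val R1).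
  by rewrite centsC cycle_subG.
have [Pr Pv1] : (p.-group [~: P, <[y]>] /\ p.-group <[v]>)%g.
  by split; [exact: pgroupS P_pgroup | apply: pgroupS P_pgroup; rewrite cycle_subG].
have [_ /(Cauchy p_prime)[a Ra oa] _] := pgroup_pdiv Pr ntR.
have ntv : <[v]>%G != 1%G by rewrite -val_eqE /= cycle_eq1.
have [_ /(Cauchy p_prime)[b vb ob] _] := pgroup_pdiv Pv1 ntv.
have cycP : cyclic P by rewrite Pu cycle_cyclic.
have Pa := subsetP sRP a Ra.
have Pb : b \in P by apply: subsetP vb; rewrite cycle_subG.
(* A cyclic group has one subgroup of each order, so a is a power of b and commutes with y. *)
have /eqP ab : (<[a]> == <[b]>)%g.
  by rewrite (eq_subG_cyclic cycP) ?cycle_subG // -!orderE oa ob.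
have : a \in ('C_[~: P, <[y]>](<[y]>))%g.
  apply/setIP; split=> //; have: a \in <[b]>%g by rewrite -ab cycle_id.
  apply: subsetP; rewrite cycle_subG.
  have cvy : (<[v]> \subset 'C(<[y]>))%g by apply: cents_cycle; apply: commute_sym.
  exact: subsetP cvy b vb.
rewrite tiC => /set1gP a1; move: oa; rewrite a1 order1 => p1.
by have := p_prime; rewrite -p1.
Qed.

Lemma centPJ x g : ((x ^ g)%g \in 'C(P)%g) = (x \in 'C(P)%g).
Proof. by rewrite memJ_norm // (subsetP (cent_norm _)) ?P_norm. Qed.

(** The p'-part of the centraliser: C(P) is P times this group. *)
Definition E0 := ('C_E(P))%G.

Lemma E0E h : h \in E0 -> h \in E. Proof. by case/setIP. Qed.
Lemma E0C h : h \in E0 -> h \in 'C(P)%g. Proof. by case/setIP. Qed.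

Lemma centP_split x : x \in 'C(P)%g -> exists i h,
  [/\ (i < N)%N, h \in E0 & x = (u ^+ i * h)%g].
Proof.
move=> cx; have Pv := mem_divgr (memPE x).
have [i Ei] := memPX Pv; exists (i %% N)%N, (remgr P E x).
rewrite ltn_pmod ?order_gt0 // expg_mod_order -Ei -divgr_eq; split=> //.
rewrite inE mem_remgr ?memPE //= -(groupMl _ (P_cent Pv)).
by rewrite -divgr_eq.
Qed.

Lemma E0J h g : h \in E0 -> (h ^ g)%g \in E0.
Proof.
move=> E0h; have [v [e [Pv Ee ->]]] := memPE_split g.
have -> : (h ^ (v * e) = h ^ e)%g.
  by rewrite conjgM (conjgE h v) (centP (E0C E0h)) // mulKg.
by apply/setIP; rewrite centPJ E0C // memJ_norm ?E0E // (subsetP (normG _)).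
Qed.

Lemma expu_E0 (i j : nat) h : (i < N)%N -> (j < N)%N -> h \in E0 ->
  ((u ^- i * (u ^+ j * h))%g \in E0) = (i == j).
Proof.
move=> iN jN E0h; rewrite mulgA groupMr //; apply/idP/eqP => [H|->]; last first.
  by rewrite mulVg group1.
have [_ _ tiPE] := sdP.
have : (u ^- i * u ^+ j)%g \in (P :&: E)%g.
  by rewrite inE E0E // groupMl ?groupV ?expu_P.
rewrite tiPE => /set1gP/eqP; rewrite -eq_mulVg1 eq_expg_mod_order.
by rewrite !modn_small // => /eqP.
Qed.

Lemma cardE0_neq0 : #|E0|%:R != 0 :> k.
Proof.
rewrite -(dvdn_pcharf pk); have [PE _ tiPE] := sdP.
have p'E : (p^'.-group E)%g.
  have /and3P[_ _] := sylP.
  by rewrite -divgS ?subsetT // -(sdprod_card defG) mulKn.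
have := pgroupS (subsetIl E 'C(P)%g : E0 \subset E) p'E.
by rewrite /pgroup p'natE ?p_prime.
Qed.

Fact e0_key : unit. Proof. by []. Qed.
Definition e0 : A := locked_with e0_key ((#|E0|%:R)^-1 *: \sum_(h in E0) gb h).

Lemma e0E x : e0 x = (x \in E0)%:R / #|E0|%:R.
Proof.
rewrite /e0 unlock galgZ galg_sumE mulrC; congr (_ * _).
have [E0x|E0x] := boolP (x \in E0); last first.
  by rewrite big1 // => h E0h; rewrite gbE; case: eqP E0x => // ->; rewrite E0h.
rewrite (bigD1 x) //= gbE eqxx big1 ?addr0 // => h /andP[_ /negPf].
by rewrite gbE eq_sym => ->.
Qed.

Lemma gb_e0 h : h \in E0 -> gb h * e0 = e0.
Proof.
by move=> E0h; apply/ffunP=> x; rewrite gb_mull !e0E groupMl ?groupV.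
Qed.

Lemma e0_idem : e0 * e0 = e0.
Proof.
rewrite {1}/e0 unlock -scalerAl mulr_suml (eq_bigr (fun _ => e0)) => [|h]; last exact: gb_e0.
by rewrite sumr_const -scaler_nat scalerA mulVf ?scale1r ?cardE0_neq0.
Qed.

(** Since [E0] is stable under conjugation by G, its average is central. *)
Lemma gb_e0C g : gb g * e0 = e0 * gb g.
Proof.
apply/ffunP=> x; rewrite gb_mull gb_mulr !e0E; congr ((nat_of_bool _)%:R / _).
apply/idP/idP=> [/(@E0J _ g^-1%g)|/(@E0J _ g)].
  by rewrite conjgE invgK mulgA mulKVg.
by rewrite conjgE mulgKV.
Qed.

Lemma e0C (a : A) : a * e0 = e0 * a.
Proof.
have := @lin_ext k gT (fun a => a * e0) (fun a => e0 * a).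
apply=> [||g]; last exact: gb_e0C.
  by split=> *; rewrite ?mulrDl ?scalerAl.
by split=> *; rewrite ?mulrDr ?scalerAr.
Qed.

Lemma der_e0 D : der D -> D e0 = 0.
Proof.
by move=> dD; apply: (der_idem0 dD e0_idem) => a; rewrite e0C.
Qed.

(** A derivation twisted by [chi]: it obeys Leibniz against the left factor u and commutes with left
    multiplication by E0. *)
Definition delta (a : A) : A := [ffun x => ell x * a x].

Lemma delta_lin : lin delta.
Proof.
split=> [a b|c a]; apply/ffunP=> x; rewrite ?(ffunE, galgD, galgZ).
  by rewrite mulrDr.
by rewrite mulrCA.
Qed.

Lemma delta_gb g : delta (gb g) = ell g *: gb g.
Proof.
apply/ffunP=> x; rewrite galgZ ffunE gbE.
by case: eqP => [->|]; rewrite ?mulr0.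
Qed.

Lemma delta_u (b : A) : delta (gb u * b) = gb u * b + gb u * delta b.
Proof.
apply/ffunP=> x; rewrite galgD ffunE !gb_mull ffunE.
rewrite -[X in ell X](mulKVg u x) ellM (ell_P mem_u) lgu.
by rewrite (chi_cent (P_cent mem_u)) mul1r mulrDl mul1r.
Qed.

Lemma delta_e0 (b : A) : delta (e0 * b) = e0 * delta b.
Proof.
rewrite /e0 unlock -!scalerAl (proj2 delta_lin) !mulr_suml (lin_sum _ _ _ delta_lin).
congr (_ *: _); apply: eq_bigr => h E0h; apply/ffunP=> x.
rewrite ffunE !gb_mull ffunE -[X in ell X](mulKVg h x) ellM.
by rewrite (ell_E (E0E E0h)) (chi_cent (E0C E0h)) mul1r add0r.
Qed.

Fact ev_key : unit. Proof. by []. Qed.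
Definition ev F : A := locked_with ev_key (horner_alg (gb u) F).

Lemma evX : ev 'X = gb u. Proof. by rewrite /ev unlock horner_algX. Qed.
Lemma evC c : ev c%:P = c%:A. Proof. by rewrite /ev unlock horner_algC. Qed.
Lemma evM F G : ev (F * G) = ev F * ev G. Proof. by rewrite /ev !unlock rmorphM. Qed.
Lemma evD F G : ev (F + G) = ev F + ev G. Proof. by rewrite /ev !unlock rmorphD. Qed.
Lemma evB F G : ev (F - G) = ev F - ev G. Proof. by rewrite /ev !unlock rmorphB. Qed.
Lemma evZ c F : ev (c *: F) = c *: ev F. Proof. by rewrite -mul_polyC evM evC -scalerAl mul1r. Qed.
Lemma ev0 : ev 0 = 0. Proof. by rewrite /ev !unlock rmorph0. Qed.
Lemma evXn n : ev 'X^n = gb (u ^+ n)%g.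
Proof. by rewrite /ev unlock rmorphXn /= horner_algX gbX. Qed.

Lemma delta_ev F (b : A) :
  delta (ev F * b) = ev ('X * F^`()) * b + ev F * delta b.
Proof.
exact: (twisted_leibniz (proj1 delta_lin) (proj2 delta_lin) delta_u ev0 evX evC evD evM).
Qed.

Definition dpoly F (a : A) : A := ev F * e0 * delta a.

Lemma dpoly_lin F : lin (dpoly F).
Proof.
split=> [a b|c a]; rewrite /dpoly.
  by rewrite (proj1 delta_lin) mulrDr.
by rewrite (proj2 delta_lin) scalerAr.
Qed.

(** With X standing for u, [dpoly F] acts on polynomials in u as e0 times the field F X d/dX; this
    is the coefficient of the bracket of two such fields. *)
Definition wronsk F G := 'X * (F * G^`() - G * F^`()).

Lemma dpoly_lbr F G a : lbr (dpoly F) (dpoly G) a = dpoly (wronsk F G) a.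
Proof. exact: (twisted_bracket e0C e0_idem delta_ev delta_e0 evM evB). Qed.

Lemma e0_dpoly F a : e0 * dpoly F a = dpoly F a.
Proof. exact: (idem_absorb e0C e0_idem). Qed.

Lemma dpoly_e0 F a : dpoly F (e0 * a) = e0 * dpoly F a.
Proof. by rewrite /dpoly delta_e0; exact: (idem_move e0C e0_idem). Qed.

(** The twist [chi g] in [ellM] is absorbed on moving F(u) e0 past g. *)
Lemma dpoly_der F :
  (forall g, gb g * (ev F * e0) = chi g *: (ev F * e0 * gb g)) -> der (dpoly F).
Proof.
move=> Fchi; apply: (derP (dpoly_lin F)) => g h.
rewrite -gbM /dpoly !delta_gb ellM gbM -!scalerAr -!scalerAl !mulrA.
rewrite scalerDl; congr (_ + _).
by rewrite -[gb g * ev F * e0]mulrA Fchi -scalerAl scalerA mulrC.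
Qed.

(** Leibniz on the pair (g, u) isolates the equivariance, because u has logarithm 1. *)
Lemma dpoly_chi F g : der (dpoly F) ->
  gb g * (ev F * e0) = chi g *: (ev F * e0 * gb g).
Proof.
move/derM/(_ (gb g) (gb u)); rewrite -gbM /dpoly !delta_gb ellM gbM.
rewrite (ell_P mem_u) lgu mulr1 scale1r -!scalerAr -!scalerAl scalerDl !mulrA.
move/addrI/(congr1 (fun a => a * gb u^-1%g)); rewrite -!scalerAl.
by rewrite -!mulrA gbV !mulr1 => ->; rewrite !mulrA.
Qed.

Lemma ev_e0_coef F x : (size F <= N)%N -> (ev F * e0) x =
  \sum_(i < N) F`_i * ((u ^- i * x)%g \in E0)%:R / #|E0|%:R.
Proof.
move=> sF; have -> : ev F = \sum_(i < N) F`_i *: gb (u ^+ i)%g.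
  have -> : F = \sum_(i < N) F`_i *: 'X^i.
    rewrite -[LHS]coefK (poly_def (size F)).
    rewrite (big_ord_widen N (fun i => F`_i *: 'X^i) sF) big_mkcond /=.
    apply: eq_bigr => i _; case: ifP => // /negbT.
    by rewrite -leqNgt => /(nth_default 0) ->; rewrite scale0r.
  rewrite (big_morph ev evD ev0); apply: eq_bigr => i _.
  rewrite evZ evXn coef_sum.
  rewrite (bigD1 i) //= coefZ coefXn eqxx mulr1 big1 ?addr0 // => j ji.
  by rewrite coefZ coefXn eq_sym -(inj_eq val_inj) /= in ji *; rewrite (negPf ji) mulr0.
rewrite mulr_suml galg_sumE; apply: eq_bigr => i _.
by rewrite -scalerAl galgZ gb_mull e0E mulrA.
Qed.

(** The cosets u^i E0 are disjoint, so the coefficients of F can be read off F(u) e0. *)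
Lemma ev_e0_cent F i h : (size F <= N)%N -> (i < N)%N -> h \in E0 ->
  (ev F * e0) (u ^+ i * h)%g = F`_i / #|E0|%:R.
Proof.
move=> sF iN E0h; rewrite ev_e0_coef // (bigD1 (Ordinal iN)) //=.
rewrite expu_E0 // eqxx mulr1 big1 ?addr0 // => j.
rewrite -(inj_eq val_inj) /= => /negPf ji.
by rewrite expu_E0 // ji mulr0 mul0r.
Qed.

Lemma ev_e0_ncent F x : (size F <= N)%N -> x \notin 'C(P)%g ->
  (ev F * e0) x = 0.
Proof.
move=> sF cx; rewrite ev_e0_coef // big1 // => i _.
have [/E0C|_] := boolP ((u ^- i * x)%g \in E0); last by rewrite mulr0 mul0r.
have cui : (u ^- i)%g \in 'C(P)%G by rewrite groupV; apply/P_cent/expu_P.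
by rewrite (groupMl _ cui) => cx'; case/negP: cx.
Qed.

(** Two readings of the crossed homomorphism on g u = (g u g^-1) g; the contributions of g
    cancel. *)
Lemma der_coefJ D g x : der D -> commute x u ->
  D (gb (u ^ g^-1)%g) (x ^ g^-1 * u ^ g^-1)%g = D (gb u) (x * u)%g.
Proof.
move=> dD cxu; set w := (u ^ g^-1)%g; set y := (x ^ g^-1)%g.
have wg : (w * g = g * u)%g by rewrite /w conjgE invgK !mulgA mulgKV.
have yw : (y ^ w)%g = y.
  by apply/conjg_fixP/commgP; rewrite /commute /y /w -!conjMg cxu.
have yg : (y ^ g)%g = x by rewrite /y -conjgM mulVg conjg1.
have := der_coefM w g y dD; rewrite wg der_coefM // yw yg addrC.
by move/addIr.
Qed.

Lemma e0_der D : der D -> der (fun a => e0 * D a).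
Proof.
move=> [D1 D2 D3]; split=> [a b|c a|a b].
- by rewrite D1 mulrDr.
- by rewrite D2 scalerAr.
by rewrite D3 mulrDr !mulrA -(e0C a).
Qed.

(* The polynomial F collects the coefficients of e0 D(u) at xu for x in P: the
   p-elements commuting with some x outside C(P) are trivial. *)
Lemma e0_der_dpoly D : der D -> exists F,
  der (dpoly F) /\ inner (fun a => e0 * D a - dpoly F a).
Proof.
move=> /e0_der; set D' := (fun a => e0 * D a) => dD'.
pose phi x := D' (gb u) (x * u)%g.
(* The factor [#|E0|] undoes the average in [e0]. *)
pose F := \poly_(i < N) (#|E0|%:R * phi (u ^+ i)%g).
have sF : (size F <= N)%N := size_poly _ _.
have fE x : x \in 'C(P)%g -> (ev F * e0) x = phi x.
  move=> /centP_split[i [h [iN E0h ->]]].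
  rewrite ev_e0_cent // coef_poly iN mulrC mulKf ?cardE0_neq0 // /phi.
  have hC j : (u ^+ j * h = h * u ^+ j)%g.
    by apply: commute_sym; apply: (centP (E0C E0h)); apply: expu_P.
  (* Left multiplication by E0 fixes e0 D(u), so its coefficients depend only on the power of u. *)
  have Dh y : D' (gb u) (h * y)%g = D' (gb u) y.
    by rewrite /D' -{1}(gb_e0 E0h) -mulrA gb_mull mulKg.
  by rewrite hC -mulgA Dh.
have dF : der (dpoly F).
  apply: dpoly_der => g; apply/ffunP=> x.
  rewrite galgZ gb_mull gb_mulr -{1}(mulgKV g x); move: (x * g^-1)%g => y.
  have -> : (g^-1 * (y * g) = y ^ g)%g by rewrite conjgE.
  have [cy|ncy] := boolP (y \in 'C(P)%g); last first.
    by rewrite !ev_e0_ncent ?centPJ ?mulr0.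
  rewrite !fE ?centPJ // /phi -(der_coefJ g dD'); last first.
    by apply: (centP _ _ mem_u); rewrite centPJ.
  (* Replacing u by g u g^-1 = u^s multiplies the coefficient by s, which is [chi g] in k. *)
  rewrite -conjgM mulgV conjg1 /chi.
  have /memPX[s ->] : (u ^ g^-1)%g \in P by rewrite memPJ mem_u.
  by rewrite der_coefX ?lgX ?mulr_natl //; apply: (centP cy _ mem_u).
exists F; split=> //.
have dB := derB dD' dF.
apply: (inner_of_pcoef pk dB) => x v v_p cxv.
have Pv : v \in P.
  rewrite (mem_normal_Hall sylP) ?inE //.
  by apply/normalP; split=> [|g _]; [exact: subsetT | exact/normP/P_norm].
have [->|v1] := eqVneq v 1%g; first by rewrite gb1 (der1 dB) galg0.
have cx := cent_of_commute Pv v1 cxv.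
have cxu : commute x u by apply: (centP cx _ mem_u).
have [i ->] := memPX Pv.
rewrite (der_coefX _ dB) // galgB /dpoly delta_gb (ell_P mem_u) lgu scale1r.
by rewrite gb_mulr mulgK fE // /phi subrr mul0rn.
Qed.

(** As u^i commutes with u, an inner derivation has coefficient zero at u^i u; here that coefficient
    is F_i up to a unit. *)
Lemma dpoly_inner0 F : inner (dpoly F) -> (size F <= N)%N -> F = 0.
Proof.
move=> iF sF; apply/polyP=> i; rewrite coef0.
have [iN|Ni] := ltnP i N; last by rewrite nth_default // (leq_trans sF).
have cu : commute (u ^+ i)%g u by apply/commute_sym/commuteX.
have := inner_eq0 iF cu.
rewrite /dpoly delta_gb (ell_P mem_u) lgu scale1r gb_mulr mulgK.
rewrite -[(u ^+ i)%g]mulg1 ev_e0_cent ?group1 // => /eqP.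
by rewrite mulf_eq0 invr_eq0 (negPf cardE0_neq0) orbF => /eqP.
Qed.

Lemma inner_lbrl D I : der D -> inner I -> inner (lbr I D).
Proof.
move=> dD iI; have := innerZ (-1) (inner_lbr dD iI).
by apply: inner_ext => a; rewrite scaleN1r /lbr opprB.
Qed.

Lemma lbr_congr D1 D2 E1 E2 : der D1 -> der D2 -> der E1 -> der E2 ->
  inner (fun a => D1 a - E1 a) -> inner (fun a => D2 a - E2 a) ->
  inner (fun a => lbr D1 D2 a - lbr E1 E2 a).
Proof.
move=> dD1 dD2 dE1 dE2 i1 i2.
have := innerD (inner_lbr dD1 i2) (inner_lbrl dE2 i1).
apply: inner_ext => a; rewrite /lbr (linB _ _ (der_lin dD1)).
rewrite (linB _ _ (der_lin dE2)).
by apply/ffunP=> x; rewrite /= !(galgD, galgN); ring.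
Qed.

(** * Solvable ideals built from families of polynomials *)

Section SolvableFamily.
Variables (fam : nat -> {poly k} -> Prop) (M : nat).
Hypotheses
  (fam_der : forall n F, fam n F -> der (dpoly F))
  (fam0 : forall n, fam n 0)
  (famD : forall n F G, fam n F -> fam n G -> fam n (F + G))
  (famZ : forall n c F, fam n F -> fam n (c *: F))
  (fam_ideal : forall F G, der (dpoly F) -> fam 0 G -> fam 0 (wronsk F G))
  (famS : forall n F G, fam n F -> fam n G -> fam n.+1 (wronsk F G))
  (famM : forall F, fam M F -> ev F * e0 = 0).

Definition fam_ders n D :=
  der D /\ exists2 F, fam n F & inner (fun a => D a - dpoly F a).

Lemma fam_ders_ext n D D' : D =1 D' -> fam_ders n D -> fam_ders n D'.
Proof.
move=> DD' [[D1 D2 D3] [F fF iF]]; split.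
  by split=> *; rewrite -!DD'; [apply: D1 | apply: D2 | apply: D3].
by exists F => //; apply: inner_ext iF => a; rewrite DD'.
Qed.

Lemma dpolyD F G a : dpoly (F + G) a = dpoly F a + dpoly G a.
Proof. by rewrite /dpoly evD !mulrDl. Qed.

Lemma dpolyZ c F a : dpoly (c *: F) a = c *: dpoly F a.
Proof. by rewrite /dpoly evZ -!scalerAl. Qed.

Lemma dpoly0 a : dpoly 0 a = 0.
Proof. by rewrite /dpoly ev0 !mul0r. Qed.

Lemma fam_dersD n D D' :
  fam_ders n D -> fam_ders n D' -> fam_ders n (fun a => D a + D' a).
Proof.
move=> [dD [F fF iF]] [dD' [G fG iG]]; split; first exact: derD.
exists (F + G); first exact: (famD fF fG).
by apply: inner_ext (innerD iF iG) => a; rewrite dpolyD opprD addrACA.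
Qed.

Lemma fam_dersZ n c D : fam_ders n D -> fam_ders n (fun a => c *: D a).
Proof.
move=> [dD [F fF iF]]; split; first exact: derZ.
exists (c *: F); first exact: (famZ _ fF).
by apply: inner_ext (innerZ c iF) => a; rewrite dpolyZ scalerBr.
Qed.

Lemma fam_ders_inner n D : inner D -> fam_ders n D.
Proof.
move=> iD; split; first exact: inner_der.
by exists 0 => //; apply: inner_ext iD => a; rewrite dpoly0 subr0.
Qed.

Lemma fam_ders_lbr n D D' :
  fam_ders n D -> fam_ders n D' -> fam_ders n.+1 (lbr D D').
Proof.
move=> [dD [F fF iF]] [dD' [G fG iG]]; split; first exact: der_lbr.
exists (wronsk F G); first exact: (famS fF fG).
have := lbr_congr dD dD' (fam_der fF) (fam_der fG) iF iG.
by apply: inner_ext => a; rewrite dpoly_lbr.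
Qed.

(* Multiplying by the central idempotent [e0] does not change the bracket with
   a derivation of the block [e0 A], so [D] may be replaced by some [dpoly F]. *)
Lemma fam_ders_ideal D D' :
  der D -> fam_ders 0 D' -> fam_ders 0 (lbr D D').
Proof.
move=> dD [dD' [G fG iG]]; split; first exact: der_lbr.
have [F [dF iF]] := e0_der_dpoly dD; have dG := fam_der fG.
exists (wronsk F G); first exact: (fam_ideal dF fG).
have i0 : inner (fun a => D a - D a).
  by apply: inner_ext (inner0 k gT) => a; rewrite subrr.
have iF0 : inner (fun a => dpoly G a - dpoly G a).
  by apply: inner_ext (inner0 k gT) => a; rewrite subrr.
have := innerD (lbr_congr dD dD' dD dG i0 iG)
  (lbr_congr (e0_der dD) dG dF dG iF iF0).
have e0L a : lbr (fun a => e0 * D a) (dpoly G) a = lbr D (dpoly G) a.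
  rewrite /lbr dpoly_e0 e0_dpoly; have := derM dD e0 (dpoly G a).
  by rewrite (der_e0 dD) mul0r add0r e0_dpoly => <-.
by apply: inner_ext => a; rewrite e0L dpoly_lbr addrA subrK.
Qed.

(** Classes are tracked modulo inner derivations, which absorbs the inner summand in [dser_mod];
    [famS] pushes each bracket to the next stage. *)
Lemma dser_fam_ders n D :
  dser_mod (fam_ders 0) (@Inn k A *%R) n D -> fam_ders n D.
Proof.
elim: n D => //= n IH _ [D1 [D2 [[m [c [Ds [Es [Dn [En ->]]]]]] [[_ iD2] ->]]]].
apply: fam_dersD; last exact: fam_ders_inner.
elim: (index_enum _) => [|i r IHr].
  by apply: fam_ders_ext (fam_ders_inner _ (inner0 k gT)) => a; rewrite big_nil.
have := fam_dersD (fam_dersZ (c i) (fam_ders_lbr (IH _ (Dn i)) (IH _ (En i)))) IHr.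
by apply: fam_ders_ext => a; rewrite big_cons.
Qed.

(** Stage 0 yields an ideal and stage M only inner derivations, so the ideal is solvable and
    semisimplicity makes it inner. *)
Lemma fam_inner : @H1_semisimple k A *%R -> forall F, fam 0 F -> inner (dpoly F).
Proof.
move=> ssH F fF; have dF := fam_der fF.
have [] //: (@Inn k A *%R) (dpoly F).
apply: (ssH (fam_ders 0)).
- split; first split=> [|D D'|c D].
  + exact/fam_ders_inner/inner0.
  + exact: fam_dersD.
  + exact: fam_dersZ.
  + by move=> D [].
  + exact: fam_ders_ideal.
- by move=> D [_ iD]; apply: fam_ders_inner.
- exists M => D /dser_fam_ders[dD [G fG iG]]; split=> //.
  apply: inner_ext iG => a.
  by rewrite /dpoly famM // mul0r subr0.
split=> //; exists F => //.
by apply: inner_ext (inner0 k gT) => a; rewrite subrr.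
Qed.

End SolvableFamily.

(** * The three obstructions: nontrivial action on P, order above p, and p = 2 *)

Lemma wronskMl c F G : wronsk (F * c) (G * c) = wronsk F G * (c * c).
Proof. by rewrite /wronsk !derivM; ring. Qed.

Lemma wronsk_const c F G : c^`() = 0 -> wronsk F (G * c) = wronsk F G * c.
Proof. by move=> c0; rewrite /wronsk derivM c0; ring. Qed.

Lemma wronsk_der F G :
  der (dpoly F) -> der (dpoly G) -> der (dpoly (wronsk F G)).
Proof.
move=> dF dG; have [D1 D2 D3] := der_lbr dF dG.
by split=> *; rewrite -!dpoly_lbr; [apply: D1 | apply: D2 | apply: D3].
Qed.

Lemma pnat_N : (p.-nat N)%N.
Proof. by have := P_pgroup; rewrite /pgroup Pu. Qed.

Lemma X1N : ('X - 1%:P) ^+ N = 'X^N - 1%:P :> {poly k}.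
Proof.
have pN : [pchar {poly k}].-nat N.
  apply: sub_in_pnat pnat_N => q _; rewrite inE => /eqP ->.
  by rewrite pchar_poly.
by rewrite exprDn_pchar // exprNn_pchar // -polyC_exp expr1n.
Qed.

(** (u - 1)^N = u^N - 1 = 0, as N is a power of p. *)
Lemma ev_dvd n F : (N <= n)%N -> ('X - 1%:P) ^+ n %| F -> ev F = 0.
Proof.
move=> Nn; case/dvdpP=> G ->; rewrite -(subnK Nn) exprD X1N.
by rewrite !evM evB evXn expg_order evC scale1r subrr !mulr0.
Qed.

Definition augm (a : A) : k := \sum_x a x.

Lemma augm_mull g (a : A) : augm (gb g * a) = augm a.
Proof.
rewrite /augm (reindex_inj (mulgI g)) /=.
by apply: eq_bigr => x _; rewrite gb_mull mulKg.
Qed.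

Lemma augm_mulr g (a : A) : augm (a * gb g) = augm a.
Proof.
rewrite /augm (reindex_inj (mulIg g)) /=.
by apply: eq_bigr => x _; rewrite gb_mulr mulgK.
Qed.

Lemma augmD (a b : A) : augm (a + b) = augm a + augm b.
Proof. by rewrite /augm -big_split; apply: eq_bigr => x _; rewrite galgD. Qed.

Lemma augmZ c (a : A) : augm (c *: a) = c * augm a.
Proof. by rewrite /augm mulr_sumr; apply: eq_bigr => x _; rewrite galgZ. Qed.

Lemma augm_ev F (a : A) : augm (ev F * a) = F.[1] * augm a.
Proof.
elim/poly_ind: F a => [|F c IH] a.
  by rewrite ev0 horner0 !mul0r -[0](scale0r (0 : A)) augmZ mul0r.
rewrite evD evM evX evC mulrDl augmD -mulrA IH augm_mull -scalerAl mul1r augmZ.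
by rewrite !hornerE mulrDl.
Qed.

Lemma augm_e0 : augm e0 = 1.
Proof.
rewrite /augm (eq_bigr _ (fun x _ => e0E x)) -mulr_suml -natr_sum.
rewrite -big_mkcond /= sum1_card mulfV ?cardE0_neq0 //.
Qed.

(** Augmenting the equivariance relation gives F(1) = chi(g) F(1). *)
Lemma dvd_X1_der g F : chi g != 1 -> der (dpoly F) -> 'X - 1%:P %| F.
Proof.
move=> g1 /(dpoly_chi g)/(congr1 augm).
rewrite augm_mull augmZ augm_mulr augm_ev augm_e0 mulr1 => F1.
rewrite dvdp_XsubCl; apply/rootP/eqP; apply: contraNT g1 => F0.
by apply/eqP/(mulIf F0); rewrite mul1r -F1.
Qed.

(** Expand [ell] on g x g^-1; the terms from g and g^-1 cancel because [chi x] is 1. *)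
Lemma ellJ x g : x \in 'C(P)%g -> ell (x ^ g^-1)%g = chi g * ell x.
Proof.
move=> cx; have := ellM g g^-1; rewrite mulgV (ell_E (group1 _)) => ell0.
rewrite conjgE invgK mulgA ellM ellM chiM (chi_cent cx) mulr1 addrAC.
by rewrite -ell0 add0r.
Qed.

(* Inversion turns the factor [chi g] of [ellJ] into its inverse; the junk value
   0^-1 = 0 takes care of the exponents divisible by p. *)
Definition invlog_poly : {poly k} := \poly_(i < N) (i%:R)^-1.

Lemma invlog_der : der (dpoly invlog_poly).
Proof.
have sF : (size invlog_poly <= N)%N := size_poly _ _.
have fE x : x \in 'C(P)%g ->
    (ev invlog_poly * e0) x = (ell x)^-1 / #|E0|%:R.
  move=> /centP_split[i [h [iN E0h ->]]].
  rewrite ev_e0_cent // coef_poly iN ellM (ell_E (E0E E0h)) mulr0 addr0.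
  by rewrite (ell_P (expu_P i)) lgX.
apply: dpoly_der => g; apply/ffunP=> x.
rewrite galgZ gb_mull gb_mulr -{1}(mulgKV g x); move: (x * g^-1)%g => y.
have -> : (g^-1 * (y * g) = y ^ g)%g by rewrite conjgE.
have [cy|ncy] := boolP (y \in 'C(P)%g); last first.
  by rewrite !ev_e0_ncent ?centPJ ?mulr0.
rewrite !fE ?centPJ // mulrA; congr (_ * _).
rewrite -[in RHS](conjgK g y) ellJ ?centPJ // invfM mulrA mulfV ?chi_neq0 //.
by rewrite mul1r.
Qed.

Lemma N_gt1 : (1 < N)%N.
Proof. by rewrite ltn_neqAle eq_sym order_eq1 u1 N_gt0. Qed.

Lemma chi_semisimple : @H1_semisimple k A *%R -> forall g, chi g = 1.
Proof.
move=> ssH g; apply/eqP/negPn/negP=> g1.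
(* With this shift of the exponent, stage 0 contains every equivariant polynomial. *)
pose fam n F := der (dpoly F) /\ ('X - 1%:P) ^+ n.+1 %| F.
have fam1 F : der (dpoly F) -> fam 0%N F.
  by move=> dF; split; rewrite // expr1; apply: dvd_X1_der g1 dF.
have famS n F G : fam n F -> fam n G -> fam n.+1 (wronsk F G).
  move=> [dF /dvdpP[F1 EF]] [dG /dvdpP[G1 EG]]; split; first exact: (wronsk_der dF dG).
  (* The exponents add up to 2n + 2, at least the required n + 2. *)
  rewrite EF EG wronskMl -exprD dvdp_mull // dvdp_exp2l //.
  by rewrite addSn !ltnS leq_addl.
have /dpoly_inner0 F0 : inner (dpoly invlog_poly).
  apply: (fam_inner (fam := fam) (M := N)) ssH _ (fam1 _ invlog_der).
  - by move=> n F [].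
  - move=> n; split; last exact: dvdp0.
    have [D1 D2 D3] := inner_der (inner0 k gT).
    by split=> *; rewrite !dpoly0; [apply: D1 | apply: D2 | apply: D3].
  - move=> n F G [dF F1] [dG G1]; split; last exact: dvdp_add.
    have [D1 D2 D3] := derD dF dG.
    by split=> *; rewrite !dpolyD; [apply: D1 | apply: D2 | apply: D3].
  - move=> n c F [dF F1]; split; last by rewrite -mul_polyC dvdp_mull.
    have [D1 D2 D3] := derZ c dF.
    by split=> *; rewrite !dpolyZ; [apply: D1 | apply: D2 | apply: D3].
  - by move=> F G dF [dG _]; apply: fam1; apply: (wronsk_der dF dG).
  - exact: famS.
  by move=> F [_ /ev_dvd->]; rewrite ?mul0r.
(* Yet the coefficient at X is 1^-1 = 1, and it is present because N > 1. *)
have := F0 (size_poly _ _) => /polyP/(_ 1%N).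
by rewrite coef_poly N_gt1 invr1 coef0 => /eqP; rewrite oner_eq0.
Qed.

(** If g u g^-1 = u^s with s congruent to 1 modulo p, then u^(N/p) is fixed; commuting with one
    nontrivial element of P forces centralising P. *)
Lemma chi1_cent g : chi g = 1 -> g \in 'C(P)%g.
Proof.
have [s Es] : exists s, (u ^ g^-1 = u ^+ s)%g by apply: memPX; rewrite memPJ mem_u.
rewrite /chi Es lgX => s1; rewrite -groupV.
have s_gt0 : (0 < s)%N.
  by case: s s1 {Es} => // /eqP; rewrite eq_sym oner_eq0.
have ps : (p %| s - 1)%N by rewrite (dvdn_pcharf pk) natrB // s1 subrr.
have [r Nr] := dvdnP dvdn_pN.
have r_gt0 : (0 < r)%N by have := N_gt0; rewrite Nr; case: (r).
have v1 : (u ^+ r)%g != 1%g.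
  rewrite -order_dvdn Nr; apply/negP=> /(dvdn_leq r_gt0).
  by rewrite leqNgt ltn_Pmulr // prime_gt1 ?p_prime.
apply: (cent_of_commute (expu_P r) v1); apply/commute_sym/commgP/conjg_fixP.
rewrite conjXg Es -expgM -[s](subnK s_gt0) mulnDl mul1n expgD.
case/dvdnP: ps => t ->; rewrite -mulnA [(p * r)%N]mulnC -Nr mulnC.
by rewrite expgM expg_order expg1n mul1g.
Qed.

Section Central.
Hypothesis cG : forall g, g \in 'C(P)%g.

Lemma ev_central g F : gb g * ev F = ev F * gb g.
Proof.
have gu : gb g * gb u = gb u * gb g.
  by rewrite -!gbM; congr gb; apply: (centP (cG g) _ mem_u).
elim/poly_ind: F => [|F c IH]; first by rewrite ev0 mulr0 mul0r.
rewrite evD evM evX evC mulrDr mulrDl mulrA IH -!mulrA gu.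
by rewrite -scalerAl -scalerAr mul1r mulr1.
Qed.

Lemma dpoly_central F : der (dpoly F).
Proof.
apply: dpoly_der => g; rewrite (chi_cent (cG g)) scale1r.
by rewrite mulrA ev_central -!mulrA gb_e0C.
Qed.

Lemma X1_neq0 n : ('X - 1%:P) ^+ n != 0 :> {poly k}.
Proof. by rewrite expf_neq0 // polyXsubC_eq0. Qed.

Lemma order_p_semisimple : @H1_semisimple k A *%R -> N = p.
Proof.
move=> ssH; apply/eqP/negPn/negP=> Np.
have ltpN : (p.*2 <= N)%N.
  have /dvdnP[[|[|r]] Nr] := dvdn_pN; first by have := N_gt0; rewrite Nr.
    by rewrite Nr mul1n eqxx in Np.
  by rewrite Nr -mul2n leq_mul2r !ltnS leq0n orbT.
have lepN : (p <= N)%N by rewrite (leq_trans _ ltpN) // -addnn leq_addr.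
pose c : {poly k} := ('X - 1%:P) ^+ (N - p).
(* As p divides N - p, [c] is a power of (X - 1)^p, whose derivative is zero. *)
have c'0 : c^`() = 0.
  rewrite /c; have /dvdnP[r ->] : (p %| N - p)%N.
    by rewrite dvdn_subr // dvdn_pN.
  rewrite mulnC exprM deriv_exp deriv_exp -(mulr_natr _ p).
  suff -> : p%:R = 0 :> {poly k} by rewrite mulr0 mul0r mul0rn.
  by rewrite -polyC_natr (pcharf0 pk).
(* A Wronskian of two multiples of [c] is divisible by c^2, hence by (X - 1)^N because 2p <= N; one
   bracket suffices. *)
pose fam n F := ('X - 1%:P) ^+ (if n is 0%N then (N - p)%N else N) %| F.
have /dpoly_inner0 F0 : inner (dpoly c).
  apply: (fam_inner (fam := fam) (M := 1%N)) ssH _ (dvdpp _).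
  - by move=> *; apply: dpoly_central.
  - by move=> n; apply: dvdp0.
  - by move=> n F G; apply: dvdp_add.
  - by move=> n d F; rewrite /fam -mul_polyC; apply: dvdp_mull.
  - move=> F G _ /dvdpP[G1 ->]; rewrite wronsk_const // ; exact: dvdp_mulIr.
  - move=> n F G /dvdpP[F1 ->] /dvdpP[G1 ->]; rewrite wronskMl -exprD.
    rewrite /fam dvdp_mull // dvdp_exp2l //; case: (n) => [|_]; last exact: leq_addr.
    rewrite -(leq_add2r p.*2) -{2}addnn addnACA subnK // leq_add2l //.
  by move=> F /ev_dvd ->; rewrite ?mul0r.
have := X1_neq0 (N - p); rewrite -/c F0 ?eqxx //.
by rewrite size_exp_XsubC -subSn // leq_subLR -addn1 addnC leq_add2r prime_gt0 ?p_prime.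
Qed.

Lemma odd_p_semisimple : @H1_semisimple k A *%R -> p <> 2%N.
Proof.
move=> ssH p2.
have deriv2 (F : {poly k}) : F^`()^`() = 0.
  apply/polyP=> n; rewrite !coef_deriv coef0 -mulrnA -mulr_natr.
  suff -> : (n.+2 * n.+1)%:R = 0 :> k by rewrite mulr0.
  apply/eqP; rewrite -(dvdn_pcharf pk) p2 dvdn2 oddM /=.
  by case: (odd n).
(* In characteristic 2 the equation selects the polynomials with odd exponents only. For two of them
   F X G' and G X F' both equal F G, so the ideal is abelian. *)
pose fam n F := if n is 0%N then 'X * F^`() = F else F = 0.
have fX : fam 0%N 'X by rewrite /fam derivX mulr1.
have /dpoly_inner0 F0 : inner (dpoly 'X).
  apply: (fam_inner (fam := fam) (M := 1%N)) ssH _ fX.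
  - by move=> *; apply: dpoly_central.
  - by case=> [|n] //=; rewrite deriv0 mulr0.
  - by case=> [|n] F G /= fF fG; rewrite ?derivD ?mulrDr fF fG ?addr0.
  - by case=> [|n] d F /= fF; rewrite ?derivZ -?scalerAr fF ?scaler0.
  - move=> F G _ /= fG.
    have -> : wronsk F G = F * G - 'X * G * F^`().
      by rewrite -[in F * G]fG /wronsk; ring.
    (* The term in F'' vanishes in characteristic 2; multiplying the result by X returns the
       Wronskian. *)
    have -> : (F * G - 'X * G * F^`())^`() = F * G^`() - G * F^`().
      by rewrite derivB !derivM derivX deriv2 fG; ring.
    by rewrite mulrBr mulrCA fG mulrA.
  - case=> [|n] F G /= fF fG; last by rewrite fF fG /wronsk !mul0r subrr mulr0.
    by rewrite /wronsk mulrBr !(mulrCA 'X) fF fG mulrC subrr.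
  by move=> F /= ->; rewrite ev0 mul0r.
have := F0; rewrite size_polyX => /(_ N_gt1)/eqP.
by rewrite polyX_eq0.
Qed.

End Central.
End NormalCyclicSylow.

(** * Central idempotents of a semisimple group algebra *)

Section CentralIdempotents.
Variables (k : closedFieldType) (gT : finGroupType) (K : {group gT}).
Local Notation A := (grpalg k gT).
Local Notation aG := (regular_repr k K).
Local Notation R_G := (group_ring k K).
Local Notation nG := #|K|.
Hypothesis p'K : ([pchar k]^'.-group K)%g.

(** Coordinates in the matrix model [group_ring k K], through which its Wedderburn decomposition is
    carried into kG. *)
Definition gring_coef (X : 'M[k]_nG) (x : gT) : k := gring_proj x X 0 0.
Definition gring_galg (X : 'M[k]_nG) : A := \sum_(x in K) gring_coef X x *: gb k x.

Lemma gring_galgD X Y : gring_galg (X + Y) = gring_galg X + gring_galg Y.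
Proof.
rewrite /gring_galg -big_split; apply: eq_bigr => x _.
by rewrite /gring_coef linearD mxE scalerDl.
Qed.

Lemma gring_galgZ c X : gring_galg (c *: X) = c *: gring_galg X.
Proof.
rewrite /gring_galg scaler_sumr; apply: eq_bigr => x _.
by rewrite /gring_coef linearZ mxE scalerA.
Qed.

Lemma gring_galg0 : gring_galg 0 = 0.
Proof. by rewrite -(scale0r 0) gring_galgZ scale0r. Qed.

Lemma gring_galg_sum (I : Type) (r : seq I) (Q : pred I) (F : I -> 'M[k]_nG) :
  gring_galg (\sum_(i <- r | Q i) F i) = \sum_(i <- r | Q i) gring_galg (F i).
Proof. exact: (big_morph _ gring_galgD gring_galg0). Qed.

Lemma gring_coef_repr x y : x \in K -> y \in K ->
  gring_coef (aG y) x = (x == y)%:R.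
Proof. by move=> Kx Ky; rewrite /gring_coef gring_projE //; case: eqP; rewrite mxE. Qed.

Lemma gring_galg_repr x : x \in K -> gring_galg (aG x) = gb k x.
Proof.
move=> Kx; rewrite /gring_galg (bigD1 x) //= gring_coef_repr // eqxx scale1r.
rewrite big1 ?addr0 // => y /andP[Ky /negPf yx].
by rewrite gring_coef_repr // yx scale0r.
Qed.

Lemma gring_galgE (a : gT -> k) :
  gring_galg (\sum_(x in K) a x *: aG x) = \sum_(x in K) a x *: gb k x.
Proof.
by rewrite gring_galg_sum; apply: eq_bigr => x Kx; rewrite gring_galgZ gring_galg_repr.
Qed.

Lemma gring_galg_supp X x : x \notin K -> gring_galg X x = 0.
Proof.
move=> Kx; rewrite galg_sumE big1 // => y Ky; rewrite galgZ gbE.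
by case: eqP Kx => [->|]; rewrite ?Ky ?mulr0.
Qed.

Lemma gring_galgM X Y : (X \in R_G)%MS -> (Y \in R_G)%MS ->
  gring_galg (X *m Y) = gring_galg X * gring_galg Y.
Proof.
move=> /envelop_mxP[a ->] /envelop_mxP[b ->]; rewrite !gring_galgE.
rewrite mulmx_suml gring_galg_sum mulr_suml; apply: eq_bigr => x Kx.
rewrite mulmx_sumr gring_galg_sum mulr_sumr; apply: eq_bigr => y Ky.
rewrite -scalemxAl -scalemxAr -repr_mxM // !gring_galgZ gring_galg_repr ?groupM //.
by rewrite gbM -scalerAl -scalerAr.
Qed.

Lemma gring_galg1 : gring_galg 1%:M = 1.
Proof. by rewrite -(repr_mx1 aG) gring_galg_repr. Qed.

Lemma gring_galg_eq0 X : (X \in R_G)%MS -> gring_galg X = 0 -> X = 0.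
Proof.
move=> /envelop_mxP[a ->]; rewrite gring_galgE => a0.
rewrite big1 // => x Kx; suff -> : a x = 0 by rewrite scale0r.
have := congr1 (fun f : A => f x) a0; rewrite galg0 galg_sumE (bigD1 x) //=.
rewrite galgZ gbE eqxx mulr1 big1 ?addr0 // => y /andP[_ /negPf yx].
by rewrite galgZ gbE eq_sym yx mulr0.
Qed.

Lemma galg_gring (z : A) : (forall x, x \notin K -> z x = 0) ->
  gring_galg (\sum_(x in K) z x *: aG x) = z.
Proof.
move=> zK; rewrite gring_galgE [RHS]galg_basis [RHS](bigID (mem K)) /=.
by rewrite [X in _ + X]big1 ?addr0 // => x /zK ->; rewrite scale0r.
Qed.

Lemma repr_in_gring x : x \in K -> (aG x \in R_G)%MS.
Proof. exact: envelop_mx_id. Qed.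

(** As |K| is invertible in the algebraically closed field k, kK is split semisimple: the block
    identities are the idempotents, and the centre of each block consists of scalars. *)
Lemma central_idempotents : exists m (e : 'I_m -> A),
  [/\ \sum_i e i = 1,
      forall i, e i != 0 /\ (forall x, x \notin K -> e i x = 0),
      forall i j, e i * e j = if i == j then e i else 0,
      forall i x, x \in K -> e i * gb k x = gb k x * e i
    & forall i (z : A), (forall x, x \notin K -> z x = 0) ->
        (forall x, x \in K -> z * gb k x = gb k x * z) ->
        exists c, e i * z = c *: e i].
Proof.
pose sG := DecSocleType aG; pose w (i : sG) := Wedderburn_id i.
have splitK : group_splitting_field k K := @group_closure_closed_field k gT K.
have sR (i : sG) : (Wedderburn_subring i <= R_G)%MS.
  have /eqmxP/andP[sumR _] := Wedderburn_sum_pchar sG p'K.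
  by apply: submx_trans sumR; apply: (sumsmx_sup i).
have wR i : (w i \in R_G)%MS.
  exact: submx_trans (Wedderburn_id_mem i) (sR i).
have wid (i : sG) := Wedderburn_is_id_pchar p'K i.
exists #|{: sG}|, (fun i => gring_galg (w (enum_val i))); split.
- transitivity (gring_galg (\sum_i w i)).
    rewrite gring_galg_sum (reindex (@enum_val sG sG)) //=.
    exact/onW_bij/enum_val_bij.
  by rewrite Wedderburn_sum_id_pchar // gring_galg1.
- move=> i; split; last exact: gring_galg_supp.
  apply/eqP=> /(gring_galg_eq0 (wR _)); case: (wid (enum_val i)) => nz _ _ _.
  exact/eqP.
- move=> i j; rewrite -gring_galgM //; case: eqP => [<-|ij].
    by case: (wid (enum_val i)) => _ wi idw _; rewrite idw.
  rewrite (@Wedderburn_mulmx0 _ _ _ sG (enum_val i) (enum_val j)) ?gring_galg0 //.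
  - by rewrite (inj_eq enum_val_inj); apply/eqP.
  - exact: Wedderburn_id_mem.
  exact: Wedderburn_id_mem.
- move=> i x Kx; rewrite -gring_galg_repr // -!gring_galgM ?repr_in_gring //.
  congr gring_galg; set j := enum_val i.
  have : (w j \in 'Z(R_G))%MS.
    rewrite (Wedderburn_center_pchar sG p'K splitK).
    by apply: (eq_row_sub (enum_rank j)); rewrite rowK enum_rankK.
  by move/center_mxP=> [_ cw]; rewrite cw ?repr_in_gring.
move=> i z zK zc; set j := enum_val i.
pose Z := \sum_(x in K) z x *: aG x.
have RZ : (Z \in R_G)%MS by apply/envelop_mxP; exists z.
have BZ : gring_galg Z = z by apply: galg_gring.
have cZ X : (X \in R_G)%MS -> X *m Z = Z *m X.
  move=> /envelop_mxP[a ->]; rewrite mulmx_suml mulmx_sumr.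
  apply: eq_bigr => x Kx; rewrite -scalemxAl -scalemxAr; congr (_ *: _).
  apply/eqP; rewrite -subr_eq0; apply/eqP/gring_galg_eq0.
    by rewrite linearB /= addmx_sub ?eqmx_opp ?envelop_mxM ?repr_in_gring.
  rewrite -scaleN1r gring_galgD gring_galgZ !gring_galgM ?repr_in_gring //.
  by rewrite BZ gring_galg_repr // zc // scaleN1r subrr.
have [nz wj idw idw'] := wid j.
have : (w j *m Z \in 'Z(Wedderburn_subring j))%MS.
  have RwZ : (w j *m Z \in Wedderburn_subring j)%MS.
    have /andP[_ idr] := Wedderburn_ideal j.
    by apply: submx_trans idr; rewrite mem_mulsmx.
  apply/center_mxP; split=> // X RX.
  have RGX : (X \in R_G)%MS := submx_trans RX (sR j).
  by rewrite mulmxA idw' // -mulmxA -cZ // mulmxA idw.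
rewrite (Wedderburn_subring_center_pchar p'K splitK) => /sub_rVP[c Ec].
exists c; rewrite -BZ -gring_galgM // -gring_galgZ; congr gring_galg.
by apply: (can_inj mxvecK); rewrite Ec linearZ.
Qed.

End CentralIdempotents.

(** * Direct products with a group of order p *)

Section DirectProduct.
Variables (k : closedFieldType) (gT : finGroupType) (p : nat).
Variables (K C : {group gT}) (u : gT).
Hypotheses (pk : p \in [pchar k]) (defG : (K \x C)%g = [set: gT])
  (p'K : (p^'.-group K)%g) (oC : #|C| = p) (Cu : (C :=: <[u]>)%g).
Local Notation A := (grpalg k gT).
Local Notation T := {ffun 'I_p -> k^o}.
Local Notation tmul := (@trunc_mul k p).
Local Notation der := (@is_der k A *%R).
Local Notation inner := (@is_inner k A *%R).
Local Notation gb := (@gb k gT).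
Implicit Types (F G : {poly k}) (a b z : A) (s t : T) (g h x : gT).

Lemma order_u : #[u]%g = p. Proof. by rewrite -oC Cu. Qed.

Lemma u_neq1 : u != 1%g.
Proof.
by rewrite -order_eq1 order_u neq_ltn prime_gt1 ?orbT // (pcharf_prime pk).
Qed.

Lemma C_sylow : (p.-Sylow([set: gT]) C)%g.
Proof.
have [_ defKC _ tiKC] := dprodP defG.
rewrite /pHall subsetT /= -divgS ?subsetT // -defKC TI_cardMg //.
rewrite mulnK ?cardG_gt0 // /pgroup oC pnat_id ?(pcharf_prime pk) //=.
Qed.

Lemma sdC : (C ><| K)%g = [set: gT].
Proof.
have [_ defKC cKC tiKC] := dprodP defG.
by rewrite sdprodEY ?(subset_trans _ (cent_sub C)) // 1?centsC // 1?setIC //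
  joingC cent_joinEr // -1?centsC.
Qed.

Lemma u_central g : commute u g.
Proof.
have [_ defKC cKC _] := dprodP defG.
have : g \in (K * C)%g by rewrite defKC inE.
case/imset2P=> x c Kx Cc ->; apply: commuteM.
  by apply: (centsP cKC) => //; rewrite Cu cycle_id.
have := Cc; rewrite Cu => /cycleP[i ->]; exact/commuteX.
Qed.

Lemma cent_C g : g \in 'C(C)%g.
Proof.
apply/centP => c; rewrite Cu => /cycleP[i ->].
exact/commuteX/commute_sym/u_central.
Qed.

(** All p-elements lie in the central group C, and coefficients at a power of u are multiples of
    those at u. *)
Lemma inner_of_u D : der D -> D (gb u) = 0 -> inner D.
Proof.
move=> dD Du; apply: (inner_of_pcoef pk dD) => x v v_p cxv.
have : v \in C.
  rewrite (mem_normal_Hall C_sylow) ?inE //.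
  apply/normalP; split=> [|g _]; first exact: subsetT.
  by apply/normP; rewrite (subsetP (cent_sub C)) ?cent_C.
rewrite Cu => /cycleP[i ->].
by rewrite (der_coefX _ dD) ?Du ?galg0 ?mul0rn //; apply/commute_sym/u_central.
Qed.

(** The nilpotent generator of kC, in the role of X in k[X]/(X^p). *)
Definition w : A := gb u - 1.

Lemma w_pow : w ^+ p = 0.
Proof.
rewrite /w -(horner_algX (gb u)) -(rmorph1 (horner_alg (gb u))) -rmorphB -rmorphXn.
have -> : ('X - 1) ^+ p = 'X^p - 1 :> {poly k}.
  have pN : [pchar {poly k}].-nat p.
    rewrite pnatE ?(pcharf_prime pk) //; by rewrite pchar_poly.
  by rewrite exprDn_pchar // exprNn_pchar // expr1n.
by rewrite rmorphB rmorphXn rmorph1 /= horner_algX -gbX -order_u expg_order subrr.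
Qed.

Fact hw_key : unit. Proof. by []. Qed.
Definition hw F : A := locked_with hw_key (horner_alg w F).

Lemma hwX : hw 'X = w. Proof. by rewrite /hw unlock horner_algX. Qed.
Lemma hwC c : hw c%:P = c%:A. Proof. by rewrite /hw unlock horner_algC. Qed.
Lemma hwD F G : hw (F + G) = hw F + hw G.
Proof. by rewrite /hw !unlock rmorphD. Qed.
Lemma hwM F G : hw (F * G) = hw F * hw G.
Proof. by rewrite /hw !unlock rmorphM. Qed.
Lemma hw0 : hw 0 = 0. Proof. by rewrite /hw unlock rmorph0. Qed.
Lemma hw1 : hw 1 = 1. Proof. by rewrite /hw unlock rmorph1. Qed.
Lemma hwZ c F : hw (c *: F) = c *: hw F.
Proof. by rewrite -mul_polyC hwM hwC -scalerAl mul1r. Qed.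

Lemma hwXD1n n : hw (('X + 1) ^+ n) = gb (u ^+ n)%g.
Proof.
elim: n => [|n IH]; first exact: hw1.
by rewrite exprS hwM IH hwD hwX hw1 /w subrK expgS gbM.
Qed.

Definition central z := forall a, z * a = a * z.

Lemma central_gb z : (forall g, z * gb g = gb g * z) -> central z.
Proof.
move=> zg a; apply: (@lin_ext k gT (fun a => z * a) (fun a => a * z)) => //.
  by split=> *; rewrite ?mulrDr ?scalerAr.
by split=> *; rewrite ?mulrDl ?scalerAl.
Qed.

Lemma centralM a b : central a -> central b -> central (a * b).
Proof. by move=> ca cb c; rewrite -mulrA cb mulrA ca mulrA. Qed.

Lemma w_central : central w.
Proof.
apply: central_gb => g.
by rewrite mulrBl mulrBr mul1r mulr1 -!gbM u_central.
Qed.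

Lemma hw_central F : central (hw F).
Proof.
move=> a; elim/poly_ind: F => [|F c IH]; first by rewrite hw0 mul0r mulr0.
rewrite hwD hwM hwX hwC (mulrDl (hw F * w)) (mulrDr a); congr (_ + _).
  by rewrite -mulrA (w_central a) mulrA IH -mulrA.
by rewrite -scalerAl -scalerAr mul1r mulr1.
Qed.

Lemma der_central D z : der D -> central z -> central (D z).
Proof.
move=> dD cz a; have := congr1 D (cz a); rewrite !(derM dD) (cz (D a)).
by rewrite [RHS]addrC => /addIr.
Qed.

Definition iota t : A := hw (rpoly t).

Lemma iota_central t : central (iota t). Proof. exact: hw_central. Qed.

Lemma iota_tpoly F : iota (tpoly p F) = hw F.
Proof.
have E0 G : tpoly p G = 0 -> hw G = 0.
  move=> G0; rewrite -(poly_take_drop p G).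
  have -> : take_poly p G = 0.
    apply/polyP=> i; rewrite coef_take_poly coef0; case: ifP => // ip.
    by have := congr1 (fun t : T => t (Ordinal ip)) G0; rewrite !ffunE.
  rewrite add0r hwM.
  have -> : hw 'X^p = 0 by rewrite /hw unlock rmorphXn /= horner_algX w_pow.
  by rewrite mulr0.
apply/eqP; rewrite -subr_eq0 -scaleN1r -hwZ -hwD; apply/eqP/E0.
by rewrite tpolyD tpolyZ rpolyK scaleN1r subrr.
Qed.

Lemma iotaD s t : iota (s + t) = iota s + iota t.
Proof. by rewrite -(rpolyK s) -(rpolyK t) -tpolyD !iota_tpoly hwD. Qed.

Lemma iotaZ c t : iota (c *: t) = c *: iota t.
Proof. by rewrite -(rpolyK t) -tpolyZ !iota_tpoly hwZ. Qed.

Lemma iotaM s t : iota (tmul s t) = iota s * iota t.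
Proof. by rewrite -(rpolyK s) -(rpolyK t) -tpolyM !iota_tpoly hwM. Qed.

Lemma iota0 : iota 0 = 0.
Proof. by rewrite -(scale0r 0) iotaZ scale0r. Qed.

Lemma iotaB s t : iota (s - t) = iota s - iota t.
Proof. by rewrite -scaleN1r iotaD iotaZ scaleN1r. Qed.

Lemma mem_KC g : exists x (j : 'I_p), x \in K /\ g = (x * u ^+ j)%g.
Proof.
have [_ defKC _ _] := dprodP defG.
have : g \in (K * C)%g by rewrite defKC inE.
case/imset2P=> x c Kx; rewrite Cu => /cycleP[i ->] ->.
have ip : (i %% p < p)%N by rewrite ltn_pmod ?prime_gt0 ?(pcharf_prime pk).
by exists x, (Ordinal ip); rewrite /= -order_u expg_mod_order.
Qed.

Lemma mulKC_inj x (i j : nat) : x \in K -> (i < p)%N -> (j < p)%N ->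
  ((x * u ^+ i * u ^- j)%g \in K) = (i == j).
Proof.
move=> Kx ip jp; have [_ _ _ tiKC] := dprodP defG.
apply/idP/eqP => [H|->]; last by rewrite mulgK.
have : (u ^+ i * u ^- j)%g \in (K :&: C)%g.
  by rewrite inE -(groupMl _ Kx) mulgA H Cu groupM ?groupV ?mem_cycle.
rewrite tiKC => /set1gP/eqP; rewrite -eq_mulgV1 eq_expg_mod_order order_u.
by rewrite !modn_small // => /eqP.
Qed.

Lemma K_coef (e : A) (c : nat -> k) x (i : nat) :
  (forall y, y \notin K -> e y = 0) -> x \in K -> (i < p)%N ->
  (\sum_(j < p) c j *: (e * gb (u ^+ j)%g)) (x * u ^+ i)%g = c i * e x.
Proof.
move=> eK Kx ip; rewrite galg_sumE (bigD1 (Ordinal ip)) //=.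
rewrite galgZ gb_mulr mulgK big1 ?addr0 // => j.
rewrite -(inj_eq val_inj) /= eq_sym => /negPf ji.
by rewrite galgZ gb_mulr eK ?mulr0 // mulKC_inj // ji.
Qed.

Variables (m : nat) (e : 'I_m -> A).
Hypotheses (e_sum : \sum_i e i = 1)
  (e_supp : forall i, e i != 0 /\ (forall x, x \notin K -> e i x = 0))
  (e_mul : forall i j, e i * e j = if i == j then e i else 0)
  (e_cent : forall i x, x \in K -> e i * gb x = gb x * e i)
  (e_scal : forall i (z : A), (forall x, x \notin K -> z x = 0) ->
        (forall x, x \in K -> z * gb x = gb x * z) ->
        exists c, e i * z = c *: e i).

Lemma e_central i : central (e i).
Proof.
apply: central_gb => g; have [x [j [Kx ->]]] := mem_KC g.
rewrite gbM mulrA (e_cent i Kx) -!mulrA; congr (_ * _).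
apply/ffunP=> y; rewrite gb_mulr gb_mull; congr (e i _).
exact/commuteV/commuteX/commute_sym/u_central.
Qed.

(** Slice z along the cosets K u^j. Each slice is central in kK, hence acts as a scalar on e_i, and
    these scalars form a polynomial in u. *)
Lemma component_ex i z : central z -> exists t, e i * z = e i * iota t.
Proof.
move=> cz; pose zc (j : 'I_p) : A :=
  [ffun x => if x \in K then z (x * u ^+ j)%g else 0].
have zE : z = \sum_(j < p) zc j * gb (u ^+ j)%g.
  apply/ffunP=> g; have [x [i0 [Kx ->]]] := mem_KC g.
  rewrite galg_sumE (bigD1 i0) //= gb_mulr mulgK ffunE Kx big1 ?addr0 // => j.
  rewrite -(inj_eq val_inj) /= eq_sym => /negPf ji.
  by rewrite gb_mulr ffunE mulKC_inj // ji.
have zcc (j : 'I_p) x : x \in K -> zc j * gb x = gb x * zc j.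
  move=> Kx; apply/ffunP=> y; rewrite gb_mulr gb_mull !ffunE.
  rewrite groupMr ?groupV // groupMl ?groupV //; case: ifP => // Ky.
  have := congr1 (fun f : A => f (y * u ^+ j)%g) (cz (gb x)).
  rewrite gb_mulr gb_mull !mulgA => <-; congr (z _).
  by rewrite -!mulgA; congr (y * _)%g; apply/commuteX/commute_sym/u_central.
have zs (j : 'I_p) : exists c, e i * zc j = c *: e i.
  apply: e_scal => x Kx; last exact: zcc.
  by rewrite ffunE (negPf Kx).
have [c Ec] := fin_all_exists zs.
(* As u = w + 1, the powers of u are values at w of powers of X + 1. *)
exists (tpoly p (\sum_(j < p) c j *: ('X + 1) ^+ j)).
rewrite iota_tpoly (big_morph hw hwD hw0) {1}zE !mulr_sumr.
apply: eq_bigr => j _.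
by rewrite hwZ hwXD1n mulrA Ec -scalerAr -scalerAl.
Qed.

(** The shift X |-> X - 1 turns an expansion in w into one in powers of u, whose coefficients are
    visible on distinct cosets of K, at a point where e_i is nonzero. *)
Lemma iota_inj i s t : e i * iota s = e i * iota t -> s = t.
Proof.
move=> est; apply/eqP; rewrite -subr_eq0; apply/eqP.
have : e i * iota (s - t) = 0 by rewrite iotaB mulrBr est subrr.
rewrite -(rpolyK (s - t)) iota_tpoly; set F := rpoly _ => eF.
pose G := F \Po ('X - 1%:P).
have FG : F = G \Po ('X + 1%:P).
  by rewrite /G -comp_polyA comp_polyB comp_polyX comp_polyC addrK comp_polyXr.
have sG : (size G <= p)%N.
  by rewrite /G size_comp_poly2 ?size_XsubC // size_rpoly.
have eG : \sum_(j < p) G`_j *: (e i * gb (u ^+ j)%g) = 0.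
  rewrite -[RHS]eF FG; have EG : G = \sum_(j < p) G`_j *: 'X^j.
    by rewrite -[LHS](tpolyK sG) /rpoly; apply: eq_bigr => j _; rewrite ffunE.
  rewrite [in RHS]EG raddf_sum /= (big_morph hw hwD hw0) mulr_sumr.
  apply: eq_bigr => j _; rewrite comp_polyZ hwZ comp_Xn_poly -hwXD1n.
  by rewrite -scalerAr polyC1.
have [/eqP e0 eK] := e_supp i.
suff -> : F = 0 by rewrite tpoly0.
suff G0 : G = 0 by rewrite FG G0 comp_poly0.
apply/polyP=> j; rewrite coef0; have [jp|pj] := ltnP j p; last first.
  by rewrite nth_default // (leq_trans sG).
have [x ex] : exists x, e i x != 0.
  apply/existsP; apply: contra_notT e0 => /existsPn e0; apply/ffunP=> x.
  by rewrite galg0; apply/eqP; have := e0 x; rewrite negbK.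
have Kx : x \in K by apply: contraNT ex => /eK ->.
have := congr1 (fun f : A => f (x * u ^+ j)%g) eG.
rewrite (K_coef (fun j => G`_j) eK Kx jp) galg0 => /eqP.
by rewrite mulf_eq0 (negPf ex) orbF => /eqP.
Qed.

(** For central z the choice is unique by [iota_inj], and the laws of [phi] follow from that
    uniqueness. *)
Definition component i z : T :=
  epsilon (inhabits 0) (fun t => e i * z = e i * iota t).

Lemma componentP i z : central z -> e i * z = e i * iota (component i z).
Proof. by move=> cz; apply: epsilon_spec (component_ex i cz). Qed.

Definition phi (D : A -> A) i t := component i (D (iota t)).

Lemma phiP D i t : der D -> e i * iota (phi D i t) = e i * D (iota t).
Proof. by move=> dD; rewrite -componentP //; apply/der_central/iota_central. Qed.

Lemma der_e D i : der D -> D (e i) = 0.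
Proof.
move=> dD; have ee := e_mul i i; rewrite eqxx in ee.
exact: (der_idem0 dD ee (e_central i)).
Qed.

Lemma phi_uniq D i s t : der D ->
  e i * D (iota s) = e i * iota t -> phi D i s = t.
Proof. by move=> dD est; apply: (@iota_inj i); rewrite (phiP i s dD). Qed.

Lemma phi_is_der D i : der D -> is_der tmul (phi D i).
Proof.
move=> dD; have [D1 D2 _] := dD; split=> [a b|c a|a b]; apply: (phi_uniq dD).
- rewrite (iotaD a b) D1 mulrDr (iotaD (phi D i a)).
  rewrite (mulrDr (e i) (iota (phi D i a))).
  by congr (_ + _); symmetry; apply: phiP.
- rewrite (iotaZ c a) D2 -scalerAr (iotaZ c (phi D i a)).
  rewrite -(scalerAr c (e i) (iota (phi D i a))).
  by congr (_ *: _); symmetry; apply: phiP.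
rewrite (iotaM a b) (derM dD) mulrDr (iotaD (tmul (phi D i a) b)).
rewrite (mulrDr (e i) (iota (tmul (phi D i a) b))).
rewrite (iotaM (phi D i a) b) (iotaM a (phi D i b)); congr (_ + _).
  by rewrite mulrA [RHS]mulrA (phiP i a dD).
rewrite mulrA [RHS]mulrA -(iota_central a (e i)) -mulrA -[RHS]mulrA.
by congr (_ * _); symmetry; apply: phiP.
Qed.

Lemma phi_onto (F : 'I_m -> T -> T) : (forall i, is_der tmul (F i)) ->
  exists D, der D /\ forall i t, phi D i t = F i t.
Proof.
(* The derivation z delta must send u to the sum of the e_i times the prescribed images of X; the
   factor u^-1 compensates delta(u) = u. *)
move=> dF; pose z := (\sum_i e i * iota (F i (tpoly p 'X))) * gb u^-1%g.
have cz : central z.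
  apply: centralM; last first.
    apply: central_gb => g; rewrite -!gbM; congr gb.
    exact/commute_sym/commuteV/commute_sym/u_central.
  move=> a; rewrite mulr_suml mulr_sumr; apply: eq_bigr => i _.
  exact: (centralM (e_central i) (iota_central _)).
pose D a := z * delta C K u a.
have lD : lin D.
  split=> [a b|c a]; rewrite /D.
    by rewrite (proj1 (delta_lin _ _ _ _)) mulrDr.
  by rewrite (proj2 (delta_lin _ _ _ _)) scalerAr.
have dD : der D.
  (* Since C is central, [chi] is trivial and [delta] is an untwisted derivation. *)
  apply: (derP lD) => g h; rewrite -gbM /D !delta_gb.
  rewrite (ellM pk C_sylow sdC Cu u_neq1) (chi_cent pk C_sylow Cu u_neq1 (cent_C g)).
  rewrite mul1r scalerDl mulrDr gbM -!scalerAr -scalerAl.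
  congr (_ *: _ + _ *: _); first exact: mulrA.
  by rewrite (mulrA z) (mulrA (gb g)) (cz (gb g)).
exists D; split=> // i; apply: tder_eq => //; first exact: phi_is_der.
apply: (phi_uniq dD); rewrite iota_tpoly hwX.
have -> : D w = \sum_j e j * iota (F j (tpoly p 'X)).
  rewrite /w (linB _ _ lD) (der1 dD) subr0 /D delta_gb.
  rewrite (ell_P _ _ _ (mem_u Cu)) (lgu pk C_sylow Cu u_neq1) scale1r /z.
  by rewrite -mulrA gbVl mulr1.
rewrite mulr_sumr (bigD1 i) //= mulrA e_mul eqxx big1 ?addr0 // => j ji.
by rewrite mulrA e_mul eq_sym (negPf ji) mul0r.
Qed.

(** Inner derivations vanish on the centre. Conversely, zero components at X give D(w) = 0, hence
    D(u) = 0. *)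
Lemma phi_inner D : der D -> (forall i t, phi D i t = 0) <-> inner D.
Proof.
move=> dD; split=> [phi0|[z zD] i t]; last first.
  by apply: (phi_uniq dD); rewrite zD (iota_central t z) subrr iota0.
apply: inner_of_u => //.
have Dw : D w = 0.
  rewrite -[LHS]mul1r -e_sum mulr_suml big1 // => i _.
  have := phiP i (tpoly p 'X) dD; by rewrite phi0 iota_tpoly hwX iota0 mulr0.
by have := Dw; rewrite /w (linB _ _ (der_lin dD)) (der1 dD) subr0.
Qed.

Lemma H1_iso_Witt : @H1_iso_Witt_power k A *%R p m.
Proof.
exists phi; split; first by move=> D dD i; apply: phi_is_der.
split.
- move=> D E dD dE i t; apply: (phi_uniq (derD dD dE)).
  rewrite iotaD (mulrDr (e i) (iota (phi D i t))) mulrDr.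
  by congr (_ + _); symmetry; apply: phiP.
- move=> c D dD i t; apply: (phi_uniq (derZ c dD)).
  rewrite iotaZ -(scalerAr c (e i) (iota (phi D i t))) -scalerAr.
  by congr (_ *: _); symmetry; apply: phiP.
- move=> D E dD dE i t; apply: (phi_uniq (der_lbr dD dE)); rewrite /lbr iotaB.
  rewrite (mulrBr (e i) (iota (phi D i (phi E i t)))) mulrBr.
  have eD (F G : A -> A) : der F -> der G -> e i * F (G (iota t)) = e i * iota (phi F i (phi G i t)).
    move=> dF dG; rewrite (phiP i (phi G i t) dF).
    (* Since derivations kill e_i, it passes through them and components compose. *)
    have eF (a : A) : e i * F a = F (e i * a) by rewrite (derM dF) der_e // mul0r add0r.
    by rewrite !eF (phiP i t dG).
  by congr (_ - _); apply: eD.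
- exact: phi_onto.
exact: phi_inner.
Qed.

End DirectProduct.

(** * Comparison of the three conditions *)

Lemma galg_H1_semisimple (k : fieldType) (gT : finGroupType) :
  H1_semisimple (@galg_mul k gT) <-> @H1_semisimple k (grpalg k gT) *%R.
Proof. by rewrite mulgE. Qed.

Lemma galg_H1_iso (k : fieldType) (gT : finGroupType) p m :
  H1_iso_Witt_power (@galg_mul k gT) p m <->
  @H1_iso_Witt_power k (grpalg k gT) *%R p m.
Proof. by rewrite mulgE. Qed.

Lemma semisimple_dprod (k : fieldType) (gT : finGroupType) (p a q : nat) :
  p \in [pchar k] -> (p %| #|[set: gT]|)%N ->
  #|[set: gT]| = (p ^ a * q)%N -> coprime p q ->
  #|(Syl p [set: gT])| = 1%N ->
  (forall P : {group gT}, P \in (Syl p [set: gT]) -> cyclic P) ->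
  @H1_semisimple k (grpalg k gT) *%R ->
  (exists K C : {group gT}, (K \x C)%g = [set: gT] /\ #|K| = q /\
            cyclic C /\ #|C| = p) /\ p <> 2%N.
Proof.
move=> pk pG oG cpq syl1 cycP ssH; have p_pr := pcharf_prime pk.
have /normal_sylowP[P sylP nP] : #|(Syl p [set: gT])| == 1%N by apply/eqP.
have cP : cyclic P by apply: cycP; rewrite inE.
have q_gt0 : (0 < q)%N.
  by have := cardG_gt0 [set: gT]%G; rewrite /= oG muln_gt0 => /andP[].
have oP : #|P| = (p ^ a)%N.
  rewrite (card_Hall sylP) oG p_part lognM ?expn_gt0 ?(prime_gt0 p_pr) //.
  by rewrite pfactorK // logn_coprime // addn0.
have /cyclicP[u Pu] := cP.
have u1 : u != 1%g.
  rewrite -cycle_eq1 -Pu -cardG_gt1 (card_Hall sylP) p_part_gt1.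
  by rewrite mem_primes p_pr cardG_gt0.
(* Schur-Zassenhaus supplies the p'-complement of the normal Sylow subgroup. *)
have [E Ecompl] := splitsP (SchurZassenhaus_split (pHall_Hall sylP) nP).
have [tiPE PE] := complP Ecompl.
have nPE : E \subset 'N(P)%g by rewrite (subset_trans (subsetT E)) ?normal_norm.
have sdPE : (P ><| E)%g = [set: gT] by rewrite sdprodE.
have chi1 := chi_semisimple pk sylP sdPE Pu u1 ssH.
have cG g : g \in 'C(P)%g := chi1_cent pk sylP sdPE Pu u1 (chi1 g).
have up : #[u]%g = p := order_p_semisimple pk sylP sdPE Pu u1 cG ssH.
have p2 : p <> 2%N := odd_p_semisimple pk sylP sdPE Pu u1 cG ssH.
split=> //.
have oPp : #|P| = p by rewrite Pu.
exists E, P; split.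
  have cPE : P \subset 'C(E)%g by rewrite centsC; apply/subsetP=> g _; apply: cG.
  by rewrite dprodE // 1?setIC // -(centC cPE).
split; last by [].
(* Here |P| is taken in the form p^a, so that cancelling it from p^a q leaves |E| = q. *)
have := sdprod_card sdPE; rewrite oG oP => /eqP.
by rewrite eqn_pmul2l ?expn_gt0 ?prime_gt0 // => /eqP.
Qed.

Lemma dprod_witt (k : closedFieldType) (gT : finGroupType) (p q : nat)
    (K C : {group gT}) :
  p \in [pchar k] -> coprime p q -> (K \x C)%g = [set: gT] -> #|K| = q ->
  cyclic C -> #|C| = p ->
  exists m, (0 < m)%N /\ @H1_iso_Witt_power k (grpalg k gT) *%R p m.
Proof.
move=> pk cpq defG oK /cyclicP[u Cu] oC; have p_pr := pcharf_prime pk.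
have p'K : (p^'.-group K)%g by rewrite /pgroup oK p'natE // -prime_coprime.
have pchar'K : ([pchar k]^'.-group K)%g.
  by rewrite /pgroup (eq_pnat _ (eq_negn (pcharf_eq pk))).
have [m [e [e1 eK ee ec es]]] := central_idempotents pchar'K.
exists m; split; last exact: (H1_iso_Witt pk defG p'K oC Cu e1 eK ee ec es).
(* An empty family of idempotents would sum to 0 instead of 1. *)
case: m e e1 {eK ee ec es} => // e; rewrite big_ord0 => /eqP.
by rewrite eq_sym oner_eq0.
Qed.

Theorem theorem4p1 (k : closedFieldType) (gT : finGroupType) (p a q : nat) :
  p \in [pchar k] ->
  (p %| #|[set: gT]|)%N ->
  #|[set: gT]| = (p ^ a * q)%N -> coprime p q ->
  #|(Syl p [set: gT])| = 1%N ->
  (forall P : {group gT}, P \in (Syl p [set: gT]) -> cyclic P) ->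
  [/\ (H1_semisimple (@galg_mul k gT) <->
        (exists K C : {group gT}, (K \x C)%g = [set: gT] /\ #|K| = q /\
            cyclic C /\ #|C| = p) /\ p <> 2%N),
      (H1_semisimple (@galg_mul k gT) <->
        (exists m : nat, (0 < m)%N /\ H1_iso_Witt_power (@galg_mul k gT) p m) /\ p <> 2%N)
    & ((exists K C : {group gT}, (K \x C)%g = [set: gT] /\ #|K| = q /\
            cyclic C /\ #|C| = p) /\ p <> 2%N) <->
      ((exists m : nat, (0 < m)%N /\ H1_iso_Witt_power (@galg_mul k gT) p m) /\ p <> 2%N)].
Proof.
move=> pk pG oG cpq syl1 cycP.
have i_ii : H1_semisimple (@galg_mul k gT) ->
    (exists K C : {group gT}, (K \x C)%g = [set: gT] /\ #|K| = q /\
            cyclic C /\ #|C| = p) /\ p <> 2%N.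
  by move/galg_H1_semisimple; apply: semisimple_dprod oG cpq syl1 cycP.
have ii_iii : (exists K C : {group gT}, (K \x C)%g = [set: gT] /\ #|K| = q /\
            cyclic C /\ #|C| = p) /\ p <> 2%N ->
    (exists m, (0 < m)%N /\ H1_iso_Witt_power (@galg_mul k gT) p m) /\ p <> 2%N.
  move=> [[K [C [defG [oK [cC oC]]]]] p2]; split=> //.
  have [m [m_gt0 /galg_H1_iso iso]] := dprod_witt pk cpq defG oK cC oC.
  by exists m.
have iii_i : (exists m, (0 < m)%N /\ H1_iso_Witt_power (@galg_mul k gT) p m) /\
    p <> 2%N -> H1_semisimple (@galg_mul k gT).
  move=> [[m [_ /galg_H1_iso[f [f_der [_ fZ f_lbr f_onto f_ker]]]]] p2].
  exact/galg_H1_semisimple/(witt_H1_semisimple pk p2 f_der fZ f_lbr f_onto f_ker).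
by split; split; auto.
Qed.
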